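(* Let $\omega=(\omega_x)_{x\in\mathbb{Z}}$ be a random environment, i.e. a sequence of i.i.d. random variables with values in $(0,1)$ under a probability measure $\mathsf{P}$, such that, with $\rho_0:=\frac{1-\omega_0}{\omega_0}$: (i) $\mathsf{E}[\log\rho_0]=0$; (ii) $\mathsf{P}(\varepsilon\le\omega_0\le 1-\varepsilon)=1$ for some $\varepsilon\in(0,\tfrac12)$; (iii) $\mathsf{Var}(\log\rho_0)>0$. Let $d\in\mathbb{N}$ be arbitrary and, for fixed $\omega$, let $(X^{(i)}_n)_{n\in\mathbb{N}_0}$, $i=1,\dots,d$, be $d$ independent random walks, each of which is a random walk in the same environment $\omega$ started at $0$. Then, for $\mathsf{P}$-a.e. environment $\omega$, the $d$-dimensional process $$\big(X^{(1)}_n,X^{(2)}_n,\dots,X^{(d)}_n\big)_{n\in\mathbb{N}_0}$$ is recurrent.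
   Context: $\mathbb{N}=\{1,2,\dots\}$, $\mathbb{N}_0=\mathbb{N}\cup\{0\}$. For a fixed environment $\omega\in(0,1)^{\mathbb{Z}}$, a random walk in the environment $\omega$ started at $0$ is the Markov chain $(X_n)_{n\in\mathbb{N}_0}$ on $\mathbb{Z}$ with $X_0=0$ and $P_\omega(X_{n+1}=y+1\mid X_n=y)=\omega_y=1-P_\omega(X_{n+1}=y-1\mid X_n=y)$ for all $y\in\mathbb{Z}$. For fixed $\omega$ the $d$-dimensional process is a Markov chain on $\mathbb{Z}^d$ started at the origin; recurrent means that, with probability one (under the law for fixed $\omega$), it returns to the origin $(0,\dots,0)$ infinitely often. *)

(* Defs.v *)
From HB Require Import structures.
From mathcomp Require Import all_boot all_order all_algebra finmap.
From mathcomp Require Import all_classical all_reals all_analysis.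

Set Implicit Arguments.
Unset Strict Implicit.
Unset Printing Implicit Defensive.

Import Order.TTheory GRing.Theory Num.Theory.

Local Open Scope classical_set_scope.
Local Open Scope ring_scope.

HB.instance Definition _ := isPointed.Build int 0.
HB.instance Definition _ := @isMeasurable.Build default_measure_display
  int discrete_measurable discrete_measurable0
  discrete_measurableC discrete_measurableU.

Definition log_rho (R : realType) (u : R) : R := ln ((1 - u) / u).

(* Mutual independence: the product rule over every finite subfamily. *)
Definition independent_systems (d : measure_display) (T : measurableType d)
    (R : realType) (P : probability T R) (I : choiceType)
    (F : I -> set (set T)) : Prop :=
  forall (J : {fset I}) (A : I -> set T),
    (forall i, i \in J -> F i (A i)) ->
    P (\bigcap_(i in [set` J]) A i) = (\prod_(i <- J) P (A i))%E.

Definition independent_RVs (d d' : measure_display) (T : measurableType d)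
    (S : measurableType d') (R : realType) (P : probability T R)
    (I : choiceType) (X : I -> {RV P >-> S}) : Prop :=
  independent_systems P
    (fun i => preimage_set_system [set: T] (X i) measurable).

(* The i-th process is represented by the sigma-algebra generated by all of its
   time marginals. *)
Definition independent_processes (d d' : measure_display) (T : measurableType d)
    (S : measurableType d') (R : realType) (P : probability T R)
    (I : choiceType) (X : I -> nat -> {RV P >-> S}) : Prop :=
  independent_systems P
    (fun i => <<s \bigcup_n preimage_set_system [set: T] (X i n) measurable >>).

Definition identically_distributed (d d' : measure_display)
    (T : measurableType d) (S : measurableType d') (R : realType)
    (P : probability T R) (I : Type) (X : I -> {RV P >-> S}) : Prop :=
  forall (i j : I) (B : set S), measurable B ->
    distribution P (X i) B = distribution P (X j) B.

(* P(A | B); division by zero makes it 0 when P B = 0, so every use below is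
   guarded by P B != 0. *)
Definition cond_prob (d : measure_display) (T : measurableType d)
    (R : realType) (P : probability T R) (A B : set T) : R :=
  fine (P (A `&` B)) / fine (P B).

Definition markov_chain (d d' : measure_display) (T : measurableType d)
    (S : measurableType d') (R : realType) (P : probability T R)
    (X : nat -> {RV P >-> S}) : Prop :=
  forall (n : nat) (x : nat -> S) (y : S),
    let past := [set t | forall k, (k <= n)%N -> X k t = x k] in
    P past != 0%E ->
    cond_prob P [set t | X n.+1 t = y] past =
    cond_prob P [set t | X n.+1 t = y] [set t | X n t = x n].

(* "Started at 0" is required only almost surely. *)
Definition walk_in_environment (d : measure_display) (T : measurableType d)
    (R : realType) (P : probability T R) (env : int -> R)
    (X : nat -> {RV P >-> int}) : Prop :=
  [/\ P [set t | X 0%N t = 0] = 1%E,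
      markov_chain X
    & forall (n : nat) (y : int), P [set t | X n t = y] != 0%E ->
        cond_prob P [set t | X n.+1 t = y + 1] [set t | X n t = y] = env y /\
        cond_prob P [set t | X n.+1 t = y - 1] [set t | X n t = y]
          = 1 - env y].

(* Almost surely, the origin 0 of V is visited at infinitely many times. *)
Definition recurrent (d : measure_display) (T : measurableType d)
    (R : realType) (P : probability T R) (V : zmodType)
    (Y : nat -> T -> V) : Prop :=
  {ae P, forall t, forall N : nat, exists n : nat, (N <= n)%N /\ Y n t = 0}.

(* Main.v *)
Require Import Defs.
From HB Require Import structures.
From mathcomp Require Import all_boot all_order all_algebra finmap.
From mathcomp Require Import all_classical all_reals all_analysis.
From mathcomp Require Import measurable_realfun ring lra zify.

(* Let V be the potential of the environment, V(x) - V(x-1) = log rho_x, for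
   which the walk is reversible with weights of order exp(-V). If V climbs to H
   on both sides of 0 before descending below -D, within a width W, then the
   walk stays in this valley up to times of order exp(H) with probability at
   least 1/2, and by reversibility and Cauchy-Schwarz it returns to 0 at every
   even time 2n <= exp(H)/2 with probability at least c exp(-D)/W. For
   D = H/(4d) and W <= exp(D) the return probabilities of the d-dimensional
   walk over this range of times sum to at least c^d exp(H/2).
   Such valleys exist at arbitrarily large heights: V is a centred walk with
   bounded steps on each side of 0, so by optional stopping it climbs H before
   descending H/(4d) with a probability bounded below, in a time of order H^2.
   Along rapidly growing scales these events are independent enough of the past
   for almost surely infinitely many of them to happen. *)

Set Implicit Arguments.
Unset Strict Implicit.
Unset Printing Implicit Defensive.

Import Order.TTheory GRing.Theory Num.Theory.
Import numFieldNormedType.Exports.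

Local Open Scope classical_set_scope.
Local Open Scope ring_scope.

(** * Return probabilities of reversible chains on a segment *)

(** The exceptional set of environments has to serve all walks on all probability spaces at once.
    Hence randomness of the environment enters only through one deterministic property, valleys at
    arbitrarily large heights; after that the environment is fixed. The d copies share it, so one
    valley serves every coordinate and the return probabilities multiply. This explains D = H/(4d):
    a coordinate loses exp(-D) for the floor and exp(-D) for the width, all of them together
    exp(-2dD) = exp(-H/2), while about exp(H) times are available. Divergence of the sum of return
    probabilities gives recurrence through the last visit to the origin. For the valleys, the
    obstacle is dependence between scales. Scale N looks only at increments beyond distance N, and
    its depth is at least 2CN, where C bounds the increments, so the unexamined first N of them use
    up at most half of the depth. The exit estimate is a first and second moment computation on an
    arbitrary event A not involving the sites explored, which lets it be chained: past failures,
    then the right wall, then the left wall. *)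

Lemma expr_mx_ge0 (R : realFieldType) (m : nat) (Q : 'M[R]_m.+1) n i j :
  (forall i j, 0 <= Q i j) -> 0 <= (Q ^+ n) i j.
Proof.
move=> Q0; elim: n i j => [|n IH] i j; first by rewrite expr0 mxE ler0n.
by rewrite exprS mxE sumr_ge0// => k _; rewrite mulr_ge0.
Qed.

Lemma expr_mx_row_le1 (R : realFieldType) (m : nat) (Q : 'M[R]_m.+1) n i :
  (forall i j, 0 <= Q i j) -> (forall i, \sum_j Q i j <= 1) ->
  \sum_j (Q ^+ n) i j <= 1.
Proof.
move=> Q0 Q1; elim: n i => [|n IH] i.
  rewrite expr0 (bigD1 i)//= big1 ?mxE ?eqxx ?addr0// => j ji.
  by rewrite mxE eq_sym (negbTE ji).
under eq_bigr => j _ do rewrite exprS mxE.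
rewrite exchange_big/=; apply: le_trans (Q1 i); apply: ler_sum => k _.
by rewrite -mulr_sumr ler_piMr.
Qed.

Lemma expr_mx_reversible (R : realFieldType) (m : nat) (Q : 'M[R]_m.+1)
    (p : 'I_m.+1 -> R) n i j :
  (forall i j, p i * Q i j = p j * Q j i) ->
  p i * (Q ^+ n) i j = p j * (Q ^+ n) j i.
Proof.
move=> rev; elim: n i j => [|n IH] i j.
  by rewrite expr0 !mxE eq_sym; case: eqVneq => [->//|]; rewrite !mulr0.
rewrite {1}exprS exprSr !mxE !mulr_sumr; apply: eq_bigr => k _.
by rewrite mulrA rev mulrAC IH -mulrA.
Qed.

Lemma cauchy_schwarz_weight (R : realFieldType) (I : finType) (a p : I -> R) :
  (forall i, 0 < p i) -> 0 < \sum_i p i ->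
  (\sum_i a i) ^+ 2 / (\sum_i p i) <= \sum_i a i ^+ 2 / p i.
Proof.
move=> p0 s0; set s := \sum_i p i; set b := \sum_i a i; set l := b / s.
(* With l = b / s the claim becomes termwise: it is the sum of (a i - l p i)^2 / p i >= 0. *)
have -> : b ^+ 2 / s = \sum_i (2 * l * a i - l ^+ 2 * p i).
  rewrite sumrB -!mulr_sumr -/s -/b /l; field; exact: lt0r_neq0.
apply: ler_sum => i _; rewrite ler_pdivlMr//; have := sqr_ge0 (a i - l * p i).
by nra.
Qed.

(* Reversibility and Cauchy-Schwarz turn a lower bound on the mass that has
   survived up to time n into a lower bound on the return probability at 2n;
   the mass is controlled by an almost harmonic function g. *)
Lemma reversible_return_ge (R : realFieldType) (m : nat) (Q : 'M[R]_m.+1)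
    (p g : 'I_m.+1 -> R) (o : 'I_m.+1) (k : R) n :
  (forall i j, 0 <= Q i j) -> (forall i, \sum_j Q i j <= 1) ->
  (forall i, 0 < p i) -> (forall i j, p i * Q i j = p j * Q j i) ->
  (forall i, g i <= 1) -> g o = 1 -> 0 <= k ->
  (forall i, g i - k * (i == o)%:R <= \sum_j Q i j * g j) ->
  n%:R * k <= 1 ->
  (1 - n%:R * k) ^+ 2 * (p o / \sum_i p i) <= (Q ^+ n.*2) o o.
Proof.
move=> Q0 Q1 p0 rev g1 go k0 gQ nk.
(* Each step lowers the mean of [g] by at most [k] times the mass at [o], and that mass is at most
   1. *)
have mass : 1 - n%:R * k <= \sum_j (Q ^+ n) o j * g j.
  elim: n {nk} => [|n IH].
    rewrite mul0r subr0 expr0 (bigD1 o)//= big1 ?mxE ?eqxx ?mul1r ?addr0 ?go//.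
    by move=> j jo; rewrite mxE eq_sym (negbTE jo) mul0r.
  under eq_bigr => j _ do rewrite exprSr mxE mulr_suml.
  rewrite exchange_big/=.
  apply: (@le_trans _ _ (\sum_i (Q ^+ n) o i * (g i - k * (i == o)%:R))).
    under eq_bigr => i _ do rewrite mulrBr.
    rewrite sumrB [X in _ <= _ - X](bigD1 o)//= eqxx [X in _ <= _ - (_ + X)]big1.
      have : (Q ^+ n) o o <= 1.
        apply: le_trans (expr_mx_row_le1 n o Q0 Q1).
        rewrite (bigD1 o)//= lerDl sumr_ge0// => j _.
        exact: expr_mx_ge0.
      have := @ler_wpM2l R k k0 ((Q ^+ n) o o) 1.
      rewrite -natr1 mulr1 addr0 => /[apply]; lra.
    by move=> i /negbTE ->; rewrite !mulr0.
  apply: ler_sum => i _; under eq_bigr => j _ do rewrite -mulrA.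
  by rewrite -mulr_sumr; apply: ler_wpM2l; [exact: expr_mx_ge0|].
have s0 : 0 < \sum_i p i.
  by rewrite (bigD1 o)//= ltr_pwDl// sumr_ge0// => i _; exact: ltW.
have -> : (Q ^+ n.*2) o o = p o * \sum_j ((Q ^+ n) o j) ^+ 2 / p j.
  rewrite -addnn exprD mxE mulr_sumr; apply: eq_bigr => j _.
  have /(congr1 (fun x => x / p j)) := expr_mx_reversible n j o rev.
  rewrite mulrAC mulfV ?mul1r => [->|]; last exact: lt0r_neq0.
  by ring.
rewrite mulrCA; apply: ler_wpM2l; first exact: ltW.
apply: le_trans (cauchy_schwarz_weight _ p0 s0).
apply: ler_wpM2r; first by rewrite invr_ge0 ltW.
rewrite ler_sqr ?nnegrE ?subr_ge0//; last first.
  by rewrite sumr_ge0// => j _; exact: expr_mx_ge0.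
apply: le_trans mass _; apply: ler_sum => j _.
by rewrite ler_piMr// expr_mx_ge0.
Qed.

(** The chain is killed on leaving 0..m, so rows 0 and m have total mass less than 1 when 0 < w < 1.
    Killing keeps the state space finite and bounds the unrestricted walk from below. *)
Definition birth_death_mx (R : pzRingType) (m : nat) (w : nat -> R) : 'M[R]_m.+1 :=
  \matrix_(i, j) (if j == i.+1 :> nat then w i
                  else if i == j.+1 :> nat then 1 - w i else 0).

Lemma birth_death_mxE (R : comPzRingType) (m : nat) (w g : nat -> R) (i : 'I_m.+1) :
  \sum_j birth_death_mx m w i j * g j =
  (if (i < m)%N then w i * g i.+1 else 0) +
  (if (0 < i)%N then (1 - w i) * g i.-1 else 0).
Proof.
(* At i = 0 the predecessor [i.-1] is 0 itself; the factor [(0 < i)%N%:R] removes this spurious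
   term. *)
transitivity (\sum_(j < m.+1) ((if j == i.+1 :> nat then w i * g j else 0) +
                         (if j == i.-1 :> nat then (0 < i)%N%:R * (1 - w i) * g j else 0))).
  apply: eq_bigr => j _; rewrite mxE.
  case: i => -[|i] /= lim.
    case: eqVneq => [->|ne]; first by rewrite /= addr0.
    by rewrite !mul0r add0r; case: ifP.
  case: eqVneq => [->|_].
    by rewrite (_ : (i.+2 == i) = false) ?addr0//; apply/negbTE/negP => /eqP; lia.
  by rewrite eqSS add0r eq_sym; case: eqVneq => _; rewrite ?mul0r// mul1r.
rewrite big_split -!big_mkcond/=.
rewrite (big_ord1_eq _ (fun j => w i * g j)).
rewrite (big_ord1_eq _ (fun j => (0 < i)%N%:R * (1 - w i) * g j)) ltnS.
congr (_ + _); rewrite (leq_ltn_trans (leq_pred _) (ltn_ord i)).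
by case: ltnP => _; rewrite ?mul1r ?mul0r.
Qed.

(** * Survival and return between two high walls *)

Section valley_return.
Variables (R : realFieldType) (w r : nat -> R) (o m : nat).
Hypothesis w01 : forall i, 0 < w i < 1.
Hypothesis r0 : forall i, 0 < r i.
Hypothesis wr : forall i, w i.+1 * r i.+1 = (1 - w i.+1) * r i.
Hypotheses (o0 : (0 < o)%N) (om : (o < m)%N).

Let L := \sum_(0 <= j < o) r j.
Let U := \sum_(o <= j < m) r j.

(* The probability, from i, of reaching o before 0 or m. *)
Let g i := if (i <= o)%N then (\sum_(0 <= j < i) r j) / L
           else (\sum_(i <= j < m) r j) / U.

Let sum_r_ge0 a b : 0 <= \sum_(a <= j < b) r j.
Proof. by rewrite sumr_ge0// => j _; exact: ltW. Qed.

Let L_ge : r 0%N <= L.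
Proof. by rewrite /L big_ltn// lerDl. Qed.

Let U_ge : r m.-1 <= U.
Proof.
rewrite /U -[in X in _ <= X](prednK (leq_trans _ om))// big_nat_recr/=.
  by rewrite lerDr.
by rewrite -ltnS (prednK (leq_trans _ om)).
Qed.

Let L_gt0 : 0 < L. Proof. exact: lt_le_trans L_ge. Qed.
Let U_gt0 : 0 < U. Proof. exact: lt_le_trans U_ge. Qed.

Let g_le1 i : g i <= 1.
Proof.
rewrite /g; case: leqP => [io|oi]; rewrite ler_pdivrMr// mul1r.
  by rewrite /L (big_cat_nat _ io)//= lerDl.
have [im|mi] := leqP i m; last by rewrite big_geq ?(ltW U_gt0)// ltnW.
by rewrite /U (big_cat_nat (ltnW oi) im)/= lerDr.
Qed.

Let g_ge0 i : 0 <= g i.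
Proof. by rewrite /g; case: leqP => _; rewrite divr_ge0// ltW. Qed.

Let go : g o = 1.
Proof. by rewrite /g leqnn divff// lt0r_neq0. Qed.

Let gU i : (o <= i)%N -> g i = (\sum_(i <= j < m) r j) / U.
Proof.
rewrite leq_eqVlt => /predU1P[<-|oi]; first by rewrite go divff// lt0r_neq0.
by rewrite /g leqNgt oi.
Qed.

(** In the electrical picture [r i] is the resistance of the edge from i to i+1, and 1 / (w i * r i)
    is the reversible measure. The voltage [g] is harmonic except at 0, m and [o]. At [o] its defect
    is w o * r o * (1/L + 1/U), and bounding the total resistances L and U below by their outermost
    edges [r 0] and [r m.-1] gives [k]. *)
Lemma valley_return n :
  let k := w o * r o * ((r 0%N)^-1 + (r m.-1)^-1) in
  n%:R * k <= 1 ->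
  (1 - n%:R * k) ^+ 2 * ((w o * r o)^-1 / \sum_(i < m.+1) (w i * r i)^-1) <=
  (birth_death_mx m w ^+ n.*2) (inord o) (inord o).
Proof.
move=> k nk.
have wi0 i : 0 <= w i by have := w01 i; lra.
have wi1 i : 0 <= 1 - w i by have := w01 i; lra.
have wo : nat_of_ord (@inord m o) = o by rewrite inordK// ltnS ltnW.
have := @reversible_return_ge R m (birth_death_mx m w)
  (fun i => (w i * r i)^-1) (fun i => g i) (inord o) k n.
rewrite wo; apply => //.
- by move=> i j; rewrite mxE; case: ifP => // _; case: ifP.
- move=> i; have := birth_death_mxE w (fun=> 1) i.
  under eq_bigr do rewrite mulr1.
  by move=> ->; have := w01 i; case: ifP => _; case: ifP => _; lra.
- by move=> i; rewrite invr_gt0 mulr_gt0//; case/andP: (w01 i).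
- have E i : (w i * r i)^-1 * w i = (w i.+1 * r i.+1)^-1 * (1 - w i.+1).
    have /andP[wi_gt0 _] := w01 i; have /andP[_ wi_lt1] := w01 i.+1.
    by rewrite wr; field; rewrite !gt_eqF ?subr_gt0.
  move=> i j; rewrite !mxE.
  case: (eqVneq (nat_of_ord j) i.+1) => [->|ne].
    rewrite (_ : (nat_of_ord i == i.+2) = false) ?E//.
    by apply/negbTE/negP => /eqP; lia.
  by case: (eqVneq (nat_of_ord i) j.+1) => [->|ne']; rewrite ?E// !mulr0.
- apply: mulr_ge0; first by rewrite mulr_ge0// ltW.
  by rewrite addr_ge0// invr_ge0 ltW.
move=> i; rewrite (birth_death_mxE w g) -val_eqE/= wo.
case: i => i /= im1; have {im1} im : (i <= m)%N by rewrite -ltnS.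
have [->|i0] := posnP i.
  rewrite {1}/g leq0n big_geq// mul0r sub0r addr0.
  rewrite ltn_eqF// mulr0 oppr0.
  by case: ifP => // _; rewrite mulr_ge0.
move: im; rewrite leq_eqVlt => /predU1P[->|im].
  rewrite gU ?(ltnW om)// big_geq// mul0r ltnn gtn_eqF// mulr0 subr0/=.
  by rewrite addr_ge0//; case: (0 < m)%N; rewrite ?mulr_ge0.
rewrite im; case: i i0 im => // i _ im /=.
have [io|oi|io] := ltngtP i.+1 o.
- rewrite mulr0 subr0 /g io !(ltnW io) (ltnW (ltnW io)) !big_nat_recr//= -/L.
  have := wr i; rewrite le_eqVlt => H; apply/orP; left; apply/eqP.
  (* The added bracket is zero by [wr]; with it, harmonicity left of [o] is a field identity. The
     right side is treated alike. *)
  transitivity ((\sum_(0 <= j < i) r j + r i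
     + (w i.+1 * r i.+1 - (1 - w i.+1) * r i)) / L); last by field; exact: lt0r_neq0.
  by rewrite H subrr addr0.
- rewrite mulr0 subr0 (gU (ltnW oi)) (gU (leqW (ltnW oi))) (gU (oi : (o <= i)%N)).
  rewrite (big_ltn (ltnW im)) !(big_ltn im).
  rewrite le_eqVlt; apply/orP; left; apply/eqP.
  transitivity ((\sum_(i.+2 <= j < m) r j + r i.+1
     - (w i.+1 * r i.+1 - (1 - w i.+1) * r i)) / U); last by field; exact: lt0r_neq0.
  by rewrite wr subrr subr0 addrC.
rewrite mulr1 io go gU ?leqnSn//.
have -> : g i = (L - r i) / L.
  by rewrite /g -io leqnSn /L -io big_nat_recr//= addrK.
have -> : \sum_(o.+1 <= j < m) r j = U - r o by rewrite /U (big_ltn om) addrC addKr.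
have -> : (L - r i) / L = 1 - r i / L by field; exact: lt0r_neq0.
have -> : (U - r o) / U = 1 - r o / U by field; exact: lt0r_neq0.
have E : (1 - w o) * (r i / L) = w o * r o / L by rewrite -io wr mulrA.
have : w o * r o / L + w o * r o / U <= k.
  have := wi0 o; have := ltW (r0 o) => ? ?.
  by rewrite /k mulrDr lerD// ler_wpM2l ?mulr_ge0// lef_pV2 ?posrE.
rewrite !mulrBr E !mulr1; lra.
Qed.

End valley_return.

(** * Real-valued probabilities *)

Section real_probability.
Context (d : measure_display) (T : measurableType d) (R : realType)
  (P : probability T R).

Definition prob (A : set T) : R := fine (P A).

Lemma probE A : measurable A -> P A = (prob A)%:E.
Proof. by move=> mA; rewrite fineK// fin_num_measure. Qed.

Lemma prob_ge0 A : 0 <= prob A. Proof. exact: fine_ge0. Qed.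

Lemma le_prob A B : measurable A -> measurable B -> A `<=` B -> prob A <= prob B.
Proof. by move=> mA mB AB; rewrite -lee_fin -!probE// le_measure ?inE. Qed.

Lemma probT : prob setT = 1. Proof. by rewrite /prob probability_setT. Qed.

Lemma prob_le1 A : measurable A -> prob A <= 1.
Proof. by move=> mA; rewrite -probT le_prob. Qed.

Lemma prob0 : prob set0 = 0. Proof. by rewrite /prob measure0. Qed.

Lemma probD A B : measurable A -> measurable B ->
  prob A = prob (A `&` B) + prob (A `&` ~` B).
Proof.
move=> mA mB; have mBC := measurableC mB.
apply: EFin_inj; rewrite EFinD -!probE ?(measureDI P mA mB) ?setDE 1?addeC//;
  exact: measurableI.
Qed.

Lemma probI1 A B : measurable A -> measurable B -> prob B = 1 ->
  prob (B `&` A) = prob A.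
Proof.
move=> mA mB B1; rewrite setIC (probD mA mB) -[LHS]addr0; congr (_ + _).
apply/eqP; rewrite eq_le prob_ge0/=.
have := probD measurableT mB; rewrite probT !setTI B1 => H.
have : prob (A `&` ~` B) <= prob (~` B).
  apply: le_prob => [||x []//]; last exact: measurableC.
  by apply: measurableI => //; exact: measurableC.
lra.
Qed.

Lemma prob_sum_le (I : finType) (A : I -> set T) (B : set T) :
  (forall i, measurable (A i)) -> measurable B -> trivIset setT A ->
  (forall i, A i `<=` B) -> \sum_i prob (A i) <= prob B.
Proof.
move=> mA mB tA AB.
have -> : \sum_i prob (A i) = prob (\bigcup_(i in [set: I]) A i).
  apply: EFin_inj; rewrite -probE; last exact: fin_bigcup_measurable.
  transitivity (\sum_i P (A i))%E.
    by rewrite -sumEFin; apply: eq_bigr => i _; rewrite probE.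
  rewrite measure_fin_bigcup//; last exact: finite_finset.
  rewrite fsbig_finite/=; last exact: finite_finset.
  apply: perm_big; apply: uniq_perm => [||i];
    rewrite ?index_enum_uniq ?fset_uniq//.
  by rewrite mem_index_enum in_fset_set ?in_setT//; exact: finite_finset.
apply: le_prob => //; first exact: fin_bigcup_measurable.
by move=> t [i _]; exact: AB.
Qed.

Lemma prob_bigcup_le (n : nat) (A : nat -> set T) (B : set T) :
  (forall i, measurable (A i)) -> measurable B ->
  B `<=` \bigcup_(i in `I_n) A i -> prob B <= \sum_(i < n) prob (A i).
Proof.
move=> mA mB AB; rewrite -lee_fin -probE// -sumEFin.
rewrite (eq_bigr (fun i : 'I_n => P (A i))) => [|i _]; last by rewrite probE.
by apply: content_subadditive => //; rewrite -bigcup_mkord.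
Qed.

End real_probability.

(** * Random walks in a fixed environment *)

Definition step (b : bool) : int := if b then 1 else -1.

Definition step_prob (R : realType) (env : int -> R) (b : bool) (y : int) : R :=
  if b then env y else 1 - env y.

Section walk.
Context (d : measure_display) (T : measurableType d) (R : realType)
  (P : probability T R) (env : int -> R) (X : nat -> {RV P >-> int}).
Hypothesis walkX : walk_in_environment env X.

Definition cylinder n (x : nat -> int) : set T :=
  [set t | forall k, (k <= n)%N -> X k t = x k].

Lemma measurable_at n y : measurable [set t | X n t = y].
Proof. exact: (measurable_funPTI (X n) (Y := [set y])). Qed.

Lemma cylinderS n x :
  cylinder n.+1 x = [set t | X n.+1 t = x n.+1] `&` cylinder n x.
Proof.
apply/seteqP; split => t /= => [H|[H1 H2] k].
  by split => [|k kn]; apply: H => //; exact: leqW.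
by rewrite leq_eqVlt => /predU1P[->//|]; rewrite ltnS; exact: H2.
Qed.

Lemma measurable_cylinder n x : measurable (cylinder n x).
Proof.
elim: n => [|n IH]; last first.
  by rewrite cylinderS; apply: measurableI => //; exact: measurable_at.
rewrite (_ : cylinder 0 x = [set t | X 0%N t = x 0%N]); first exact: measurable_at.
apply/seteqP; split => t /=; first by apply.
by move=> H k; rewrite leqn0 => /eqP ->.
Qed.

(** The product form avoids division, so it also holds for states of probability zero, where both
    sides vanish. *)
Lemma walk_step n y b :
  prob P ([set t | X n.+1 t = y + step b] `&` [set t | X n t = y]) =
  prob P [set t | X n t = y] * step_prob env b y.
Proof.
have [_ _ /(_ n y) cE] := walkX.
have mn := measurable_at n y; have mn1 := measurable_at n.+1 (y + step b).
have [P0|P0] := eqVneq (P [set t | X n t = y]) 0%E.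
  have z : prob P [set t | X n t = y] = 0 by rewrite /prob P0.
  rewrite z mul0r; apply/eqP; rewrite eq_le prob_ge0 -z andbT.
  by apply: le_prob => [||t []]//; exact: measurableI.
have nz : prob P [set t | X n t = y] != 0 by apply: contra P0; rewrite probE// => /eqP ->.
have {cE}[cE1 cE2] := cE P0.
case: b mn1 => _; rewrite /step_prob/= -?cE2 -?cE1 /cond_prob -!/(prob P _);
  by rewrite mulrC divfK.
Qed.

Lemma walk_cylinder n x b : x n.+1 = x n + step b ->
  prob P (cylinder n.+1 x) = prob P (cylinder n x) * step_prob env b (x n).
Proof.
move=> xn1; have mC := measurable_cylinder n x.
have mn1 := measurable_at n.+1 (x n.+1); have mn := measurable_at n (x n).
have sub : cylinder n x `<=` [set t | X n t = x n] by move=> t; exact.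
have [P0|P0] := eqVneq (P (cylinder n x)) 0%E.
  have z : prob P (cylinder n x) = 0 by rewrite /prob P0.
  rewrite z mul0r; apply/eqP; rewrite eq_le prob_ge0 -z andbT.
  apply: le_prob => //; first exact: measurable_cylinder.
  by rewrite cylinderS => t [].
have nz : prob P (cylinder n x) != 0.
  by apply: contra P0; rewrite probE// => /eqP ->.
have nz' : prob P [set t | X n t = x n] != 0.
  rewrite gt_eqF// (lt_le_trans _ (le_prob _ _ _ sub))//.
  by rewrite lt_neqAle eq_sym nz prob_ge0.
have [_ /(_ n x (x n.+1)) mk _] := walkX.
have {mk} := mk P0; rewrite /cond_prob -!/(prob P _).
rewrite {2}xn1 -/(prob P _) walk_step [RHS]mulrAC divff// mul1r => <-.
by rewrite cylinderS mulrC divfK.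
Qed.

End walk.

(** Index i of the matrix stands for the site i - a. The matrix counts only trajectories that stay
    in the window, and the events of being at distinct sites at time n are disjoint. *)
Lemma birth_death_le_walk (d : measure_display) (T : measurableType d)
    (R : realType) (P : probability T R) (env : int -> R)
    (X : nat -> {RV P >-> int}) (a m n : nat) (j : 'I_m.+1) :
  (forall y, 0 < env y < 1) -> walk_in_environment env X -> (a <= m)%N ->
  (birth_death_mx m (fun i => env (i%:Z - a%:Z)) ^+ n) (inord a) j <=
  prob P [set t | X n t = (j : nat)%:Z - a%:Z].
Proof.
move=> env01 walkX am; pose p (i : 'I_m.+1) : int := (i : nat)%:Z - a%:Z.
elim: n j => [|n IH] j.
  rewrite expr0 mxE; case: eqVneq => [<-|_]; last exact: prob_ge0.
  have [X0 _ _] := walkX.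
  by rewrite inordK// subrr /prob X0.
rewrite exprSr mxE.
apply: (@le_trans _ _ (\sum_i prob P ([set t | X n.+1 t = p j] `&` [set t | X n t = p i]))).
  apply: ler_sum => i _; rewrite mxE.
  have up := walk_step walkX n (p i) true.
  have dn := walk_step walkX n (p i) false.
  case: (eqVneq (j : nat) i.+1) => [ji|_].
    have -> : p j = p i + step true by rewrite /p ji /step; lia.
    rewrite up; apply: ler_wpM2r (IH i).
    by have /andP[/ltW] := env01 (p i).
  case: (eqVneq (i : nat) j.+1) => [ij|_]; last by rewrite mulr0 prob_ge0.
  have -> : p j = p i + step false by rewrite /p ij /step; lia.
  rewrite dn; apply: ler_wpM2r (IH i).
  by rewrite subr_ge0; have /andP[_ /ltW] := env01 (p i).
apply: prob_sum_le.
- by move=> i; apply: measurableI; exact: measurable_at.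
- exact: measurable_at.
- apply/trivIsetP => i k _ _ ik; rewrite -subset0 => t [[_ /= e1] [_ /= e2]].
  move/eqP: ik; apply; apply: val_inj => /=.
  by have := etrans (esym e1) e2; rewrite /p; lia.
- by move=> i t [].
Qed.

(** * Independent walks in one environment: a divergent sum of return probabilities implies
    recurrence *)

Section joint_walk.
Context (dT : measure_display) (T : measurableType dT) (R : realType)
  (P : probability T R) (env : int -> R) (d : nat)
  (X : 'I_d -> nat -> {RV P >-> int}).
Hypothesis env01 : forall y, 0 < env y < 1.
Hypothesis walkX : forall i, walk_in_environment env (X i).
Hypothesis indepX : independent_processes X.

Let S i : set (set T) :=
  <<s \bigcup_n preimage_set_system [set: T] (X i n) measurable >>.

Let S_at i n y : S i [set t | X i n t = y].
Proof.
apply: sub_sigma_algebra; exists n => //; exists [set y] => //.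
by rewrite setTI.
Qed.

Let S_setI i A B : S i A -> S i B -> S i (A `&` B).
Proof.
move=> SA SB.
exact: (@measurableI _ (g_sigma_algebraType
  (\bigcup_n preimage_set_system [set: T] (X i n) measurable))).
Qed.

Let S_cylinder i n x : S i (cylinder (X i) n x).
Proof.
elim: n => [|n IH]; last by rewrite cylinderS; exact: S_setI.
rewrite (_ : cylinder _ 0 x = [set t | X i 0%N t = x 0%N]) ?S_at//.
apply/seteqP; split => t /=; first by apply.
by move=> H k; rewrite leqn0 => /eqP ->.
Qed.

Let S_measurable i A : S i A -> measurable A.
Proof.
apply: smallest_sub; first exact: sigma_algebra_measurable.
by move=> _ [n _ [B mB <-]]; rewrite setTI; exact: measurable_funPTI.
Qed.

Lemma prob_indep (A : 'I_d -> set T) : (forall i, S i (A i)) ->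
  prob P [set t | forall i, A i t] = \prod_i prob P (A i).
Proof.
move=> SA; apply: EFin_inj.
have fT : finite_set [set: 'I_d] by exact: finite_finset.
have SE : [set t | forall i, A i t] = \bigcap_(i in [set` fset_set [set: 'I_d]]) A i.
  by rewrite fset_setK//; apply/seteqP; split => t /= H i; [move=> _|]; exact: H.
rewrite SE -probE; last first.
  by apply: fin_bigcap_measurable => // i _; exact: S_measurable (SA i).
rewrite indepX; last by move=> i _; exact: SA.
rewrite -prodEFin.
rewrite [RHS](eq_bigr (fun i => P (A i))) => [|i _]; last first.
  by rewrite probE//; exact: S_measurable (SA i).
apply: perm_big; apply: uniq_perm => [||i]; rewrite ?fset_uniq ?index_enum_uniq//.
by rewrite mem_index_enum in_fset_set// in_setT.
Qed.

Let state := 'I_d -> int.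
Implicit Types (x : nat -> state) (s : {ffun 'I_d -> bool}).

Definition past n x : set T :=
  [set t | forall i, cylinder (X i) n (fun k => x k i) t].

(** Only times up to [n.+1] matter; the value at later times is a filler. *)
Definition extend n x s : nat -> state :=
  fun k => if (k <= n)%N then x k else fun i => x n i + step (s i).

Definition joint_step_prob (y : state) s : R :=
  \prod_i step_prob env (s i) (y i).

Lemma measurable_joint (A : 'I_d -> set T) :
  (forall i, measurable (A i)) -> measurable [set t | forall i, A i t].
Proof.
move=> mA; rewrite (_ : [set t | _] = \bigcap_(i in [set: 'I_d]) A i).
  by apply: fin_bigcap_measurable => //; exact: finite_finset.
by apply/seteqP; split => t /= H i; [move=> _|]; exact: H.
Qed.

Lemma measurable_past n x : measurable (past n x).
Proof. by apply: measurable_joint => i; exact: measurable_cylinder. Qed.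

Lemma extend_past n x s :
  past n.+1 (extend n x s) =
  past n x `&` [set t | forall i, X i n.+1 t = x n i + step (s i)].
Proof.
apply/seteqP; split => t /=.
  move=> H; split=> i.
    move=> k kn; have := H i k (leqW kn); by rewrite /extend kn.
  by have := H i _ (leqnn _); rewrite /extend ltnn.
move=> [H1 H2] i k; rewrite leq_eqVlt => /predU1P[->|]; rewrite /extend.
  by rewrite ltnn.
by rewrite ltnS => kn; rewrite kn; exact: H1.
Qed.

Lemma prob_extend n x s :
  prob P (past n.+1 (extend n x s)) = prob P (past n x) * joint_step_prob (x n) s.
Proof.
rewrite /past !prob_indep// -big_split/=; apply: eq_bigr => i _.
rewrite (walk_cylinder (b := s i) (walkX i)); last first.
  by rewrite /extend ltnn leqnn.
congr (prob P _ * _); last by rewrite /extend leqnn.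
by apply/seteqP; split => t /= H k kn; have := H k kn; rewrite /extend kn.
Qed.

Lemma joint_step_prob_ge0 y s : 0 <= joint_step_prob y s.
Proof.
apply: prodr_ge0 => i _; rewrite /step_prob; have /andP[h1 h2] := env01 (y i).
by case: ifP => _; rewrite ?subr_ge0 ltW.
Qed.

Lemma sum_joint_step_prob y : \sum_s joint_step_prob y s = 1.
Proof.
rewrite -(bigA_distr_bigA (fun i b => step_prob env b (y i)))/=.
by rewrite big1// => i _; rewrite big_bool/=; lra.
Qed.

(** The extensions partition the past only up to a null set, since steps are +1 or -1 only almost
    surely. Instead of a set identity, the inequality for disjoint events is applied to E and to its
    complement; the two totals agree, so both are equalities. *)
Lemma prob_past_split n x E : measurable E ->
  prob P (past n x `&` E) = \sum_s prob P (past n.+1 (extend n x s) `&` E).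
Proof.
move=> mE; have mC := measurableC mE.
have le F : measurable F ->
    \sum_s prob P (past n.+1 (extend n x s) `&` F) <= prob P (past n x `&` F).
  move=> mF; apply: prob_sum_le.
  - by move=> s; apply: measurableI => //; exact: measurable_past.
  - by apply: measurableI => //; exact: measurable_past.
  - apply/trivIsetP => s s' _ _ ss'; rewrite -subset0 => t [].
    rewrite !extend_past => -[[_ /= e1] _] [[_ /= e2] _].
    move/eqP: ss'; apply; apply/ffunP => i; have := etrans (esym (e1 i)) (e2 i).
    by rewrite /step; case: (s i); case: (s' i) => //; lia.
  - by move=> s t; rewrite extend_past => -[[]].
have := probD P (measurable_past n x) mE.
have : \sum_s (prob P (past n.+1 (extend n x s) `&` E) +
    prob P (past n.+1 (extend n x s) `&` ~` E)) = prob P (past n x).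
  rewrite (eq_bigr (fun s => prob P (past n x) * joint_step_prob (x n) s)) => [|s _].
    by rewrite -mulr_sumr sum_joint_step_prob mulr1.
  by rewrite -prob_extend -(probD P (measurable_past _ _) mE).
rewrite big_split/=; have := le _ mE; have := le _ mC; lra.
Qed.

Definition at_origin n : set T := [set t | forall i, X i n t = 0].

Lemma prob_at_origin n :
  prob P (at_origin n) = \prod_i prob P [set t | X i n t = 0].
Proof. by rewrite (prob_indep (A := fun i => [set t | X i n t = 0])). Qed.

Definition no_return n M : set T :=
  [set t | forall k, (n < k <= n + M)%N -> ~ at_origin k t].

Lemma measurable_at_origin n : measurable (at_origin n).
Proof. by apply: measurable_joint => i; exact: measurable_at. Qed.

Lemma no_returnS n M :
  no_return n M.+1 = ~` at_origin n.+1 `&` no_return n.+1 M.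
Proof.
apply/seteqP; split => t /=.
  move=> H; split; first by apply: H; rewrite ltnSn addnS ltnS leq_addr.
  by move=> k /andP[h1 h2]; apply: H; rewrite ltnW// addnS -addSn.
move=> [H1 H2] k; rewrite leq_eqVlt => /andP[/predU1P[<-//|h1] h2].
by apply: H2; rewrite h1 addSn -addnS.
Qed.

Lemma measurable_no_return n M : measurable (no_return n M).
Proof.
elim: M n => [|M IH] n; last first.
  rewrite no_returnS; apply: measurableI => //.
  by apply: measurableC; exact: measurable_at_origin.
rewrite (_ : no_return n 0 = setT)//; apply/seteqP; split => t //= _ k.
by rewrite addn0 => /andP[/leq_trans /[apply]]; rewrite ltnn.
Qed.

(** The probability, from y, of not being at the origin during the next M steps, computed from the
    transition probabilities alone. Markov properties can then be stated without restarting or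
    shifting the process. *)
Fixpoint avoid M (y : state) : R :=
  if M is M'.+1 then
    \sum_s joint_step_prob y s *
      (if [forall i, y i + step (s i) == 0] then 0
       else avoid M' (fun i => y i + step (s i)))
  else 1.

Lemma prob_no_return_past M n x :
  prob P (past n x `&` no_return n M) = prob P (past n x) * avoid M (x n).
Proof.
elim: M n x => [|M IH] n x /=.
  rewrite mulr1 (_ : no_return n 0 = setT) ?setIT//; apply/seteqP.
  split => t //= _ k.
  by rewrite addn0 => /andP[/leq_trans /[apply]]; rewrite ltnn.
rewrite prob_past_split; last exact: measurable_no_return.
rewrite mulr_sumr; apply: eq_bigr => s _; rewrite mulrA -prob_extend no_returnS.
have xs : extend n x s n.+1 = fun i => x n i + step (s i) by rewrite /extend ltnn.
have at0 t : past n.+1 (extend n x s) t ->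
    at_origin n.+1 t <-> [forall i, x n i + step (s i) == 0].
  rewrite extend_past => -[_ /= e]; split.
    by move=> H; apply/forallP => i; rewrite -e H.
  by move=> /forallP H i; rewrite e; exact/eqP.
case: ifPn => [H|/negP H].
  rewrite mulr0 (_ : _ `&` _ = set0) ?prob0// -subset0 => t [pt [nt _]].
  by apply: nt; exact/at0.
rewrite -xs -IH; congr (prob P _); apply/seteqP; split => t /= [pt].
  by move=> [].
by move=> nr; split => //; split => // /(at0 _ pt).
Qed.

(** The Markov property at time j + k for the event of being at the origin. The induction refines
    the past one step at a time until it reaches that time and fixes the position. *)
Lemma prob_past_origin_no_return k M j x :
  prob P (past j x `&` (at_origin (j + k) `&` no_return (j + k) M)) =
  prob P (past j x `&` at_origin (j + k)) * avoid M (fun=> 0).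
Proof.
have mE n : measurable (at_origin n `&` no_return n M).
  apply: measurableI; first exact: measurable_at_origin.
  exact: measurable_no_return.
elim: k j x => [|k IH] j x; last first.
  rewrite !prob_past_split//; last exact: measurable_at_origin.
  by rewrite mulr_suml; apply: eq_bigr => s _; rewrite addnS -addSn IH.
rewrite addn0 !setIA.
have [x0|x0] := pselect (x j = fun=> 0).
  rewrite (_ : past j x `&` at_origin j = past j x).
    by rewrite prob_no_return_past x0.
  apply/setIidPl => t pt i; have := pt i _ (leqnn j).
  by rewrite x0.
rewrite (_ : past j x `&` at_origin j = set0) ?set0I ?prob0 ?mul0r//.
rewrite -subset0 => t [pt ot]; apply: x0; apply/funext => i.
by rewrite -(pt i _ (leqnn j)) (ot i).
Qed.

Lemma prob_origin_no_return n M :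
  prob P (at_origin n `&` no_return n M) = prob P (at_origin n) * avoid M (fun=> 0).
Proof.
have := prob_past_origin_no_return n M 0 (fun _ _ => 0).
have P1 : prob P (past 0 (fun _ _ => 0)) = 1.
  rewrite /past prob_indep//; apply: big1 => i _.
  have [X0 _ _] := walkX i.
  rewrite (_ : cylinder _ _ _ = [set t | X i 0%N t = 0]) /prob ?X0//.
  apply/seteqP; split => t /=; first by apply.
  by move=> H k; rewrite leqn0 => /eqP ->.
have mo := measurable_at_origin; have mn := measurable_no_return.
have mp := measurable_past 0 (fun _ _ => 0).
by rewrite add0n (probI1 (measurableI _ _ (mo n) (mn n M)) mp P1) (probI1 (mo n) mp P1).
Qed.

Lemma avoid_ge0 M y : 0 <= avoid M y.
Proof.
elim: M y => //= M IH y; apply: sumr_ge0 => s _.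
by rewrite mulr_ge0 ?joint_step_prob_ge0//; case: ifP.
Qed.

Lemma avoid_nonincreasing M y : avoid M.+1 y <= avoid M y.
Proof.
elim: M y => [|M IH] y.
  rewrite /= -[leRHS](sum_joint_step_prob y); apply: ler_sum => s _.
  by rewrite ler_piMr ?joint_step_prob_ge0//; case: ifP.
rewrite [leLHS]/= [leRHS]/=; apply: ler_sum => s _.
by rewrite ler_wpM2l ?joint_step_prob_ge0//; case: ifP => // _; exact: IH.
Qed.

Lemma avoid_le M N y : (M <= N)%N -> avoid N y <= avoid M y.
Proof.
move=> /subnKC <-; elim: (N - M)%N => [|k IH]; first by rewrite addn0.
by rewrite addnS (le_trans (avoid_nonincreasing _ _)).
Qed.

(* Decompose according to the last visit to the origin before time K. *)
Lemma avoid_sum_le1 K :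
  avoid K (fun=> 0) * \sum_(n < K.+1) prob P (at_origin n) <= 1.
Proof.
rewrite -(probT P) mulr_sumr.
apply: (@le_trans _ _ (\sum_(n < K.+1) prob P (at_origin n `&` no_return n (K - n)))).
  apply: ler_sum => n _; rewrite prob_origin_no_return mulrC.
  by apply: ler_wpM2l; [exact: prob_ge0|rewrite avoid_le// leq_subr].
apply: prob_sum_le => // [n|].
  by apply: measurableI; [exact: measurable_at_origin|exact: measurable_no_return].
have disj (n m : 'I_K.+1) t : (n < m)%N -> no_return n (K - n) t -> ~ at_origin m t.
  by move=> nm; apply; rewrite nm subnKC -ltnS ltn_ord.
apply/trivIsetP => n m _ _ nm; rewrite -subset0 => t [[on nn] [om mm]].
have /orP[lt|lt] : (n < m)%N || (m < n)%N by rewrite -neq_ltn.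
- exact: disj lt nn om.
- exact: disj lt mm on.
Qed.

(** By [avoid_sum_le1], divergence forces [avoid K] to tend to 0. A path that starts at the origin
    and never visits it from time N on has a last visit before N, followed by an avoidance of length
    at least K; a union bound over the N possible times finishes. *)
Lemma recurrent_of_divergence :
  (forall C : R, exists K, C <= \sum_(n < K.+1) prob P (at_origin n)) ->
  recurrent P (fun n t => \row_(i < d) X i n t).
Proof.
move=> div.
have mo := measurable_at_origin; have mn := measurable_no_return.
have avoid0 e : 0 < e -> exists K, avoid K (fun=> 0) <= e.
  move=> e0; have [K HK] := div e^-1; exists K.
  rewrite -(@ler_pM2r _ e^-1) ?invr_gt0// mulfV ?gt_eqF//.
  apply: le_trans (avoid_sum_le1 K); apply: ler_wpM2l => //.
  exact: avoid_ge0.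
pose A N := [set t | forall n, (N <= n)%N -> ~ at_origin n t].
suff A0 N : P.-negligible (A N).
  apply: negligibleS (negligible_bigcup A0) => t /= /existsNP[N HN].
  exists N => // n Nn on; apply: HN; exists n; split => //.
  by apply/rowP => i; rewrite !mxE.
have mA : measurable (A N).
  rewrite (_ : A N = \bigcap_(n in [set n | (N <= n)%N]) ~` at_origin n)//.
  by apply: bigcap_measurable => [|n _]; [exists N => /=|exact: measurableC].
apply/(negligibleP _ mA); apply: etrans (probE P mA) _; congr EFin.
apply/eqP; rewrite eq_le prob_ge0 andbT; apply/ler_addgt0Pr => e e0; rewrite add0r.
(* There are N terms in the union bound; [N.+2] exceeds N and is never zero. *)
have [K HK] : exists K, avoid K (fun=> 0) <= e / N.+2%:R.
  by apply: avoid0; rewrite divr_gt0.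
(* Indices are shifted by one: [B 0] is the null event of a wrong starting point, and [B n.+1] says
   that n is a visit with none after it up to time N + K. *)
pose B n := if n is n'.+1 then at_origin n' `&` no_return n' (N + K - n')
            else ~` at_origin 0.
have P0 : prob P (at_origin 0) = 1.
  rewrite prob_at_origin; apply: big1 => i _; have [X0 _ _] := walkX i.
  by rewrite /prob X0.
apply: (@le_trans _ _ (\sum_(n < N.+1) prob P (B n))).
  apply: prob_bigcup_le => //.
    by case=> [|n]; [exact: measurableC|exact: measurableI].
  move=> t At; have [at0|nat0] := pselect (at_origin 0 t); last by exists 0%N.
  have ex : exists n, (n < N)%N && `[< at_origin n t >].
    exists 0%N; rewrite lt0n; apply/andP; split; last exact/asboolP.
    by apply/negP => /eqP N0; apply: (At 0%N) => //; rewrite N0.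
  have bd n : (n < N)%N && `[< at_origin n t >] -> (n <= N)%N by case/andP => /ltnW.
  case: (ex_maxnP ex bd) => n /andP[nN /asboolP on] nmax.
  exists n.+1 => //; split => // k /andP[nk kK] ok.
  have [kN|Nk] := ltnP k N; last exact: (At k).
  by move: nk; rewrite ltnNge nmax// kN; apply/asboolP.
rewrite big_ord_recl/=.
have -> : prob P (~` at_origin 0) = 0.
  by have := probD P measurableT (mo 0%N); rewrite probT !setTI P0; lra.
rewrite add0r; apply: (@le_trans _ _ (\sum_(n < N) (e / N.+2%:R))).
  apply: ler_sum => n _; rewrite prob_origin_no_return.
  apply: le_trans HK; rewrite -[leRHS]mul1r; apply: ler_pM.
  - exact: prob_ge0.
  - exact: avoid_ge0.
  - exact: prob_le1.
  - by rewrite avoid_le// leq_subRL ?leq_add2r// ltnW// (leq_trans (ltn_ord n))// leq_addr.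
rewrite sumr_const card_ord -[leLHS]mulr_natr -mulrA ler_piMr ?(ltW e0)//.
by rewrite mulrC ler_pdivrMr// mul1r ler_nat leqW.
Qed.

End joint_walk.

(** * Valleys of the potential *)

Section potential.
Context (R : realType) (env : int -> R).

Definition potential_right (k : nat) : R :=
  \sum_(i < k) log_rho (env (i.+1 : nat)%:Z).

(** Going left from 0 undoes the increments at the sites 0, -1, ..., -(k-1); the site 0 therefore
    belongs to the left side. *)
Definition potential_left (k : nat) : R :=
  \sum_(i < k) - log_rho (env (- (i : nat)%:Z)).

Definition potential (x : int) : R :=
  match x with Posz k => potential_right k | Negz k => potential_left k.+1 end.

Lemma potentialN (k : nat) : potential (- k%:Z) = potential_left k.
Proof.
case: k => [|k]; last by rewrite -NegzE.
by rewrite oppr0 /= /potential_right /potential_left !big_ord0.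
Qed.

Lemma potential_step (x : int) : potential (x + 1) = potential x + log_rho (env (x + 1)).
Proof.
case: x => k.
  rewrite (_ : Posz k + 1 = Posz k.+1); last by lia.
  by rewrite /= /potential_right big_ord_recr.
rewrite (_ : Negz k + 1 = - k%:Z); last by lia.
rewrite potentialN/= /potential_left big_ord_recr/=; lra.
Qed.

Definition valley (H D : R) (A B : nat) : Prop :=
  [/\ H <= potential_left A, H <= potential_right B,
      forall j, (j <= A)%N -> - D <= potential_left j &
      forall j, (j <= B)%N -> - D <= potential_right j].

Context (d : measure_display) (T : measurableType d) (P : probability T R)
  (X : nat -> {RV P >-> int}) (eps H D : R) (A B : nat).
Hypothesis walkX : walk_in_environment env X.
Hypothesis eps0 : 0 < eps.
Hypothesis env_eps : forall x, eps <= env x <= 1 - eps.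
Hypotheses (H0 : 0 < H) (D0 : 0 <= D) (valleyAB : valley H D A B).

(** Both outermost resistances are at least exp(H), so k <= 2 exp(-H) and n k <= 1/2; the square of
    the remaining 1/2 is the 1/4 in the bound. Each of the A + B + 2 sites has reversible weight at
    most exp(D) / eps. *)
Lemma valley_return_ge n : 4 * n%:R <= expR H ->
  eps * expR (- D) / (4 * (A + B + 2)%:R) <= prob P [set t | X n.*2 t = 0].
Proof.
move=> nH.
have idxL i : (i <= A)%N -> i%:Z - A%:Z = - (A - i)%N%:Z by move=> iA; rewrite -subzn// opprB.
have idxR i : (A <= i)%N -> i%:Z - A%:Z = (i - A)%N%:Z by move=> Ai; rewrite -subzn.
have e0 := eps0; have H0' := H0; have D0' := D0.
have [HA HB DA DB] := valleyAB.
have A0 : (0 < A)%N.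
  by rewrite lt0n; apply/eqP => A0; move: HA; rewrite A0 /potential_left big_ord0; lra.
have B0 : (0 < B)%N.
  by rewrite lt0n; apply/eqP => B0; move: HB; rewrite B0 /potential_right big_ord0; lra.
(* The window is the sites from -A to B + 1; with the extra site, the last edge has resistance
   [r m.-1] = exp(V(B)), the right wall. *)
pose m := (A + B).+1.
pose w (i : nat) := env (i%:Z - A%:Z).
pose r (i : nat) := expR (potential (i%:Z - A%:Z)).
have w01 i : 0 < w i < 1 by have := env_eps (i%:Z - A%:Z); rewrite /w; lra.
have r0 i : 0 < r i by exact: expR_gt0.
have wr i : w i.+1 * r i.+1 = (1 - w i.+1) * r i.
  rewrite /r /w (_ : i.+1%:Z - A%:Z = (i%:Z - A%:Z) + 1); last by lia.
  rewrite potential_step expRD /log_rho.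
  have := env_eps (i%:Z - A%:Z + 1); move: (env _) => u u01.
  rewrite lnK; last by rewrite posrE divr_gt0//; lra.
  by field; lra.
have Am : (A < m)%N by rewrite /m ltnS leq_addr.
have r_o : r A = 1.
  by rewrite /r subrr /= /potential_right big_ord0 expR0.
have r_0 : expR H <= r 0%N.
  by rewrite /r sub0r potentialN ler_expR.
have r_m : expR H <= r m.-1.
  by rewrite /r /m /= PoszD addrC addKr /= ler_expR.
have eH : 0 < expR H by exact: expR_gt0.
have := valley_return w01 r0 wr A0 Am (n := n).
rewrite r_o mulr1.
set k := w A * _; set S := \sum_(i < m.+1) _.
have k_le : k <= 2 * (expR H)^-1.
  have h1 : (r 0%N)^-1 <= (expR H)^-1 by rewrite lef_pV2 ?posrE.
  have h2 : (r m.-1)^-1 <= (expR H)^-1 by rewrite lef_pV2 ?posrE.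
  have h3 : 0 < (r 0%N)^-1 by rewrite invr_gt0.
  have h4 : 0 < (r m.-1)^-1 by rewrite invr_gt0.
  have := w01 A; rewrite /k; nra.
have k0 : 0 <= k.
  have /andP[h1 _] := w01 A.
  by rewrite /k mulr_ge0 ?addr_ge0 ?invr_ge0 ?(ltW h1) ?(ltW (r0 _)).
have nk : n%:R * k <= 2^-1.
  have n0 : 0 <= n%:R :> R by [].
  apply: (@le_trans _ _ (n%:R * (2 * (expR H)^-1))); first exact: ler_wpM2l.
  rewrite mulrA ler_pdivrMr//; lra.
have nk0 : 0 <= n%:R * k by rewrite mulr_ge0.
have S_le : S <= (A + B + 2)%:R * (expR D / eps).
  have -> : (A + B + 2)%:R * (expR D / eps) = \sum_(i < m.+1) (expR D / eps).
    by rewrite sumr_const card_ord /m addn2 mulr_natl.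
  apply: ler_sum => i _.
  have eD (x y : R) : eps <= x -> - D <= y -> (x * expR y)^-1 <= expR D / eps.
    move=> xe yD; rewrite invfM mulrC ler_pM ?invr_ge0 ?(ltW (expR_gt0 _))//.
    - lra.
    - by rewrite -expRN ler_expR; lra.
    - by rewrite lef_pV2 ?posrE//; lra.
  case: i => -[|i] /= im.
    have /andP[h _] := env_eps (0%:Z - A%:Z).
    by apply: eD => //; rewrite sub0r potentialN DA.
  have h1 := env_eps (i.+1%:Z - A%:Z).
  have [iA|Ai] := leqP i.+1 A.
    apply: eD; first by case/andP: h1.
    by rewrite idxL// potentialN DA// leq_subr.
  have [iB|Bi] := leqP i.+1 (A + B).
    apply: eD; first by case/andP: h1.
    by rewrite (idxR _ (ltnW Ai)) /= DB// leq_subLR.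
  (* The valley says nothing about the potential at the last site B + 1; [wr] expresses its weight
     through the potential at B. *)
  rewrite wr; apply: eD; first by rewrite /w; lra.
  rewrite (idxR i Ai) /= DB// leq_subLR -ltnS.
  exact: im.
have S0 : 0 < S.
  rewrite /S (bigD1 ord0)//= ltr_pwDl//.
    by rewrite invr_gt0 mulr_gt0//; case/andP: (w01 0%N).
  by rewrite sumr_ge0// => i _; rewrite invr_ge0 ltW// mulr_gt0//; case/andP: (w01 i).
move=> /= ret; have {}ret := ret (le_trans nk (ltac:(lra) : 2^-1 <= 1 :> R)).
have env01 y : 0 < env y < 1 by have := env_eps y; lra.
have := birth_death_le_walk n.*2 (inord A) env01 walkX (ltnW Am).
rewrite inordK; last by rewrite ltnS ltnW.
rewrite subrr; apply: le_trans; apply: le_trans ret.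
have SV : eps * expR (- D) / (A + B + 2)%:R <= S^-1.
  have -> : eps * expR (- D) / (A + B + 2)%:R = ((A + B + 2)%:R * (expR D / eps))^-1.
    by rewrite expRN; field; rewrite !gt_eqF ?expR_gt0//= ltr0n addn2.
  by rewrite lef_pV2 ?posrE// mulr_gt0 ?ltr0n ?addn2// divr_gt0 ?expR_gt0.
have SV0 : 0 <= S^-1 by rewrite invr_ge0 ltW.
have wV : 1 <= (w A)^-1.
  by have /andP[h1 h2] := w01 A; rewrite invf_ge1// ltW.
have q : 4^-1 <= (1 - n%:R * k) ^+ 2 by nra.
have wS : S^-1 <= (w A)^-1 / S by rewrite ler_peMl.
rewrite invfM mulrCA; apply: ler_pM => //; last exact: le_trans wS.
by rewrite divr_ge0// mulr_ge0 ?expR_ge0// ltW.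
Qed.

End potential.

Lemma sum_even_le (R : realType) (u : nat -> R) L : (forall n, 0 <= u n) ->
  \sum_(n < L.+1) u n.*2 <= \sum_(n < L.*2.+1) u n.
Proof.
move=> u0; elim: L => [|L IH]; first by rewrite !big_ord1.
rewrite big_ord_recr doubleS 2![in leRHS]big_ord_recr/= lerD//.
by rewrite (le_trans IH)// lerDl.
Qed.

Lemma valley_recurrent (R : realType) (env : int -> R) (eps : R) (d : nat)
    (dT : measure_display) (T : measurableType dT) (P : probability T R)
    (X : 'I_d -> nat -> {RV P >-> int}) :
  (0 < d)%N -> 0 < eps -> (forall x, eps <= env x <= 1 - eps) ->
  (forall i, walk_in_environment env (X i)) -> independent_processes X ->
  (forall K : R, exists H A B, [/\ K <= H, valley env H (H / (4 * d%:R)) A B &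
     (A + B + 2)%:R <= expR (H / (4 * d%:R))]) ->
  recurrent P (fun n t => \row_(i < d) X i n t).
Proof.
move=> d0 eps0 env_eps walkX indepX valleys.
have env01 y : 0 < env y < 1 by have := env_eps y; lra.
have dR : 0 < d%:R :> R by rewrite ltr0n.
apply: (recurrent_of_divergence env01) => // C.
pose q : R := 4^-1 * (eps / 4) ^+ d.
have q0 : 0 < q by rewrite /q mulr_gt0// exprn_gt0// divr_gt0.
(* The sum of return probabilities will be at least q exp(H/2), and exp(H/2) >= H/2 >= C/q for this
   choice; the [+ 1] makes H positive. *)
have [H [A [B [KH vAB AB]]]] := valleys (`|2 * C / q| + 1).
have H0 : 0 < H by have := normr_ge0 (2 * C / q); lra.
set D := H / (4 * d%:R) in vAB AB.
have D0 : 0 <= D by rewrite /D divr_ge0 ?ltW// mulr_gt0.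
pose L := Num.truncn (expR H / 4).
have eH0 : 0 <= expR H / 4 by rewrite divr_ge0 ?expR_ge0.
exists L.*2; apply: le_trans (sum_even_le L (fun n => prob_ge0 _ _)).
have u_ge (n : 'I_L.+1) : (eps / 4 * expR (- (2 * D))) ^+ d <= prob P (at_origin X n.*2).
  rewrite (prob_at_origin indepX).
  have -> : (eps / 4 * expR (- (2 * D))) ^+ d = \prod_(i < d) (eps / 4 * expR (- (2 * D))).
    by rewrite prodr_const card_ord.
  apply: ler_prod => i _; rewrite mulr_ge0 ?expR_ge0 ?divr_ge0 ?(ltW eps0)//=.
  have nH : 4 * (n : nat)%:R <= expR H.
    have : (n : nat)%:R <= expR H / 4.
      by rewrite -truncn_ge_nat// -ltnS ltn_ord.
    lra.
  apply: le_trans (valley_return_ge (walkX i) eps0 env_eps H0 D0 vAB nH).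
  have N0 : 0 < (A + B + 2)%:R :> R by rewrite ltr0n addn2.
  rewrite (_ : - (2 * D) = - D + - D) ?expRD; last by lra.
  rewrite invfM (_ : eps / 4 * _ = eps * expR (- D) * (4^-1 * expR (- D))); last by ring.
  rewrite ler_wpM2l ?mulr_ge0 ?expR_ge0 ?(ltW eps0)// ler_wpM2l//.
  by rewrite expRN lef_pV2 ?posrE ?expR_gt0.
apply: (@le_trans _ _ (\sum_(n < L.+1) (eps / 4 * expR (- (2 * D))) ^+ d)); last first.
  by apply: ler_sum => n _; exact: u_ge.
rewrite sumr_const card_ord -[leRHS]mulr_natl exprMn -expRM_natr.
have L1 : expR H / 4 <= L.+1%:R by apply: ltW; rewrite truncnS_gt.
have -> : - (2 * D) * d%:R = - (H / 2).
  by rewrite /D; field; rewrite gt_eqF.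
apply: (@le_trans _ _ (expR H / 4 * ((eps / 4) ^+ d * expR (- (H / 2))))); last first.
  by rewrite ler_wpM2r// mulr_ge0 ?expR_ge0 ?exprn_ge0 ?divr_ge0 ?(ltW eps0).
have -> : expR H / 4 * ((eps / 4) ^+ d * expR (- (H / 2))) = q * expR (H / 2).
  rewrite {2}(_ : H / 2 = H - H / 2) ?expRD; last by lra.
  by rewrite /q; ring.
have := expR_ge1Dx (H / 2) => eH2.
have h1 : 2 * C / q <= H.
  by have := ler_norm (2 * C / q); lra.
have h2 : C / q <= expR (H / 2) by rewrite mulrAC in h1; lra.
by rewrite -ler_pdivrMl// mulrC.
Qed.

(** * Expectations of bounded independent variables *)

Section bounded_expectation.
Context (d : measure_display) (T : measurableType d) (R : realType)
  (P : probability T R).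

Definition bounded_mfun (f : T -> R) : Prop :=
  measurable_fun [set: T] f /\ exists M, forall t, `|f t| <= M.

Definition mean (f : T -> R) : R := (\int[P]_t f t)%R.

Lemma bounded_mfun_integrable f : bounded_mfun f -> P.-integrable setT (EFin \o f).
Proof.
move=> [mf [M fM]]; apply: measurable_bounded_integrable => //.
  by apply: le_lt_trans (probability_le1 P measurableT) _; rewrite ltry.
exists M; split; first exact: num_real.
by move=> x Mx t _ /=; apply: le_trans (fM t) _; exact: ltW.
Qed.

Lemma bounded_mfun_cst c : bounded_mfun (cst c).
Proof. by split; [exact: measurable_cst|exists `|c|]. Qed.

Lemma bounded_mfun_indic A : measurable A -> bounded_mfun (\1_A : T -> R).
Proof.
move=> mA; split; first exact: measurable_indic.
by exists 1 => t; rewrite indicE; case: (_ \in _); rewrite /= ?normr1 ?normr0.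
Qed.

Lemma bounded_mfunD f g : bounded_mfun f -> bounded_mfun g ->
  bounded_mfun (fun t => f t + g t).
Proof.
move=> [mf [M fM]] [mg [N gN]]; split; first exact: measurable_funD.
by exists (M + N) => t; rewrite (le_trans (ler_normD _ _))// lerD.
Qed.

Lemma bounded_mfunM f g : bounded_mfun f -> bounded_mfun g ->
  bounded_mfun (fun t => f t * g t).
Proof.
move=> [mf [M fM]] [mg [N gN]]; split; first exact: measurable_funM.
by exists (M * N) => t; rewrite normrM ler_pM.
Qed.

Lemma mean_cst c : mean (cst c) = c.
Proof. by rewrite /mean Rintegral_cst// -[RHS]mulr1; congr (_ * _); exact: probT. Qed.

Lemma meanD f g : bounded_mfun f -> bounded_mfun g ->
  mean (fun t => f t + g t) = mean f + mean g.
Proof.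
by move=> bf bg; rewrite /mean RintegralD//; exact: bounded_mfun_integrable.
Qed.

Lemma meanZ c f : bounded_mfun f -> mean (fun t => c * f t) = c * mean f.
Proof.
by move=> bf; rewrite /mean RintegralZl//; exact: bounded_mfun_integrable.
Qed.

Lemma le_mean f g : bounded_mfun f -> bounded_mfun g ->
  (forall t, f t <= g t) -> mean f <= mean g.
Proof.
move=> bf bg fg; apply: le_Rintegral => //; exact: bounded_mfun_integrable.
Qed.

Lemma mean_indic A : measurable A -> mean \1_A = prob P A.
Proof. by move=> mA; rewrite /mean /Rintegral integral_indic// setIT. Qed.

Lemma meanE f : bounded_mfun f -> (\int[P]_t (f t)%:E)%E = (mean f)%:E.
Proof.
move=> bf; rewrite /mean /Rintegral fineK//.
exact: integrable_fin_num (bounded_mfun_integrable bf).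
Qed.

Definition indep_fun (X Y : T -> R) := forall A B : set R,
  measurable A -> measurable B ->
  P (X @^-1` A `&` Y @^-1` B) = (P (X @^-1` A) * P (Y @^-1` B))%E.

Let ge0_mean_indepM X Y : bounded_mfun X -> bounded_mfun Y ->
  (forall t, 0 <= X t) -> (forall t, 0 <= Y t) -> indep_fun X Y ->
  mean (fun t => X t * Y t) = mean X * mean Y.
Proof.
move=> bX bY X0 Y0 ind; apply: EFin_inj.
rewrite EFinM -!meanE//; last exact: bounded_mfunM.
have [mX _] := bX; have [mY _] := bY.
pose X' : {RV P >-> R} := mfun_Sub (mem_set mX : X \in mfun).
pose Y' : {RV P >-> R} := mfun_Sub (mem_set mY : Y \in mfun).
have mXY : measurable_fun setT (fun t => (X t, Y t)).
  exact/measurable_fun_pairP.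
pose XY : {RV P >-> (R * R)%type} :=
  mfun_Sub (mem_set mXY : (fun t => (X t, Y t)) \in mfun).
(* Absolute values make [f] nonnegative on the whole plane, as Tonelli requires; on the values of
   the pair it is the product. *)
pose f (z : R * R) : \bar R := (`|z.1| * `|z.2|)%:E.
have mf : measurable_fun setT f.
  apply/measurable_EFinP; apply: measurable_funM.
    by apply: measurableT_comp => //; exact: measurable_fst.
  by apply: measurableT_comp => //; exact: measurable_snd.
have f0 z : (0 <= f z)%E by rewrite lee_fin.
have abs0 (x : R) : (0 <= `|x|%:E)%E by rewrite lee_fin.
have mabs : measurable_fun setT (fun x : R => `|x|%:E).
  by apply/measurable_EFinP; exact: normr_measurable.
transitivity (\int[P]_t (f \o XY) t)%E.
  by apply: eq_integral => t _; rewrite /f/= !ger0_norm.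
rewrite -(ge0_integral_distribution XY)//.
transitivity (\int[(distribution P X' \x distribution P Y')%E]_z f z)%E.
  apply: eq_measure_integral => A mA _; apply/esym.
  apply: product_measure_unique => // B C mB mC; exact: ind.
rewrite fubini_tonelli1//= /fubini_F/=.
under eq_integral => x _.
  under eq_integral => y _ do rewrite /f/= EFinM.
  rewrite ge0_integralZl_EFin//.
  over.
rewrite ge0_integralZr//; last exact: integral_ge0.
rewrite !ge0_integral_distribution//=; congr (_ * _)%E.
  by apply: eq_integral => t _; rewrite /= ger0_norm.
by apply: eq_integral => t _; rewrite /= ger0_norm.
Qed.

(** Adding the bounds M and N makes both factors nonnegative and preserves independence; the
    additional terms cancel by linearity. *)
Lemma mean_indepM X Y : bounded_mfun X -> bounded_mfun Y -> indep_fun X Y ->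
  mean (fun t => X t * Y t) = mean X * mean Y.
Proof.
move=> bX bY ind; have [mX [M XM]] := bX; have [mY [N YN]] := bY.
have bX' := bounded_mfunD bX (bounded_mfun_cst M).
have bY' := bounded_mfunD bY (bounded_mfun_cst N).
have := ge0_mean_indepM bX' bY'.
rewrite (meanD bX (bounded_mfun_cst _)) (meanD bY (bounded_mfun_cst _)) !mean_cst/= => /(_ _ _ _)H.
have bXY := bounded_mfunM bX bY.
have bNX := bounded_mfunM (bounded_mfun_cst N) bX.
have bMY := bounded_mfunM (bounded_mfun_cst M) bY.
have {H} : mean (fun t => (X t + M) * (Y t + N)) = (mean X + M) * (mean Y + N).
  apply: H.
  - by move=> t; have := XM t; rewrite ler_norml; lra.
  - by move=> t; have := YN t; rewrite ler_norml; lra.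
  - move=> A B mA mB; apply: (ind ((+%R ^~ M) @^-1` A) ((+%R ^~ N) @^-1` B)).
      rewrite -[X in measurable X]setTI; apply: measurable_funD => //; exact: measurable_cst.
    rewrite -[X in measurable X]setTI; apply: measurable_funD => //; exact: measurable_cst.
have -> : mean (fun t => (X t + M) * (Y t + N)) =
    mean (fun t => X t * Y t) + N * mean X + M * mean Y + M * N.
  rewrite -(mean_cst (M * N)) -(meanZ _ bX) -(meanZ _ bY) -(meanD bXY bNX).
  rewrite -(meanD (bounded_mfunD bXY bNX) bMY).
  rewrite -(meanD (bounded_mfunD (bounded_mfunD bXY bNX) bMY) (bounded_mfun_cst _)).
  by congr mean; apply/funext => t /=; ring.
lra.
Qed.

End bounded_expectation.

(** * Independence of one site from all the others *)

Section independent_of_others.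
Context (d : measure_display) (T : measurableType d) (R : realType)
  (P : probability T R) (I : choiceType) (X : I -> {RV P >-> R}).
Hypothesis indepX : independent_RVs X.

(** Measurability with respect to all sites but one replaces a filtration: it expresses that an
    event does not involve site i, whatever the order in which sites are explored. *)
Definition others (i : I) : set (set T) :=
  \bigcup_(j in [set j | j != i]) preimage_set_system [set: T] (X j) measurable.

Lemma others_measurable i A : <<s others i >> A -> measurable A.
Proof.
apply: smallest_sub; first exact: sigma_algebra_measurable.
by move=> _ [j _ [B mB <-]]; rewrite setTI; exact: measurable_funPTI.
Qed.

Lemma others_RV i j : j != i ->
  measurable_fun [set: g_sigma_algebraType (others i)] (X j).
Proof.
move=> ji _ B mB; apply: sub_sigma_algebra; exists j => //.
by exists B.
Qed.

(** With E the event on site i, the measures sending A to P(A and E) and to P(A) P(E) agree on the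
    pi-system of finite intersections not involving i, hence on the sigma-algebra that it
    generates. *)
Lemma prob_others i A (B : set R) : <<s others i >> A -> measurable B ->
  P (A `&` X i @^-1` B) = (P A * P (X i @^-1` B))%E.
Proof.
move=> + mB.
set E := X i @^-1` B; have mE : measurable E by exact: measurable_funPTI.
pose F j := preimage_set_system [set: T] (X j) measurable.
pose G : set (set T) := [set A | exists (K : {fset I}) (C : I -> set T),
  [/\ i \notin K, forall j, j \in K -> F j (C j) &
      A = \bigcap_(j in [set` K]) C j]].
have FT j : F j setT by exists setT => //; rewrite preimage_setT setTI.
have FI j C D : F j C -> F j D -> F j (C `&` D).
  move=> [C' mC' <-] [D' mD' <-]; exists (C' `&` D'); first exact: measurableI.
  by rewrite !setTI preimage_setI.
have FM j C : F j C -> measurable C.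
  by move=> [C' mC' <-]; rewrite setTI; exact: measurable_funPTI.
have GM : G `<=` measurable.
  by move=> _ [K [C [_ FC ->]]]; apply: fin_bigcap_measurable => // j /FC/FM.
have GI : setI_closed G.
  move=> _ _ [K [C [iK FC ->]]] [L [D [iL FD ->]]].
  (* Padding each family with [setT] outside its index set lets both be merged over the union. *)
  exists (K `|` L)%fset; exists (fun j =>
    (if j \in K then C j else setT) `&` (if j \in L then D j else setT)).
  split; first by rewrite inE negb_or iK.
  - move=> j _; apply: FI; case: ifP => // jK; [exact: FC|exact: FD].
  - apply/seteqP; split => t.
    + move=> [/= tC tD] j; rewrite /= inE => _.
      by split; case: ifP => // jK; [exact: tC|exact: tD].
    + move=> /= H; split=> j /= jK.
      * by have := H j; rewrite /= inE jK => /(_ isT)[].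
      * by have := H j; rewrite /= inE jK orbT => /(_ isT)[].
have GT : G setT.
  exists fset0; exists (fun=> setT); split => //.
  by apply/seteqP; split => t.
have PE0 : 0 <= fine (P E) by exact: fine_ge0.
have sub : <<s others i >> `<=` <<s G >>.
  apply: smallest_sub; first exact: smallest_sigma_algebra.
  move=> C [j ji FC]; apply: sub_sigma_algebra.
  exists [fset j]%fset; exists (fun=> C); split.
  - by rewrite inE eq_sym.
  - by move=> k; rewrite inE => /eqP ->.
  - apply/seteqP; split => t /= => [tC k//|]; apply => /=.
    by rewrite inE.
move=> /sub sA.
rewrite -[P E]fineK ?fin_num_measure// muleC.
apply: (g_sigma_algebra_measure_unique G GM (fun=> setT) _ _ (mrestr P mE)
  (mscale (NngNum PE0) P) GI _ _ _ sA) => //.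
- by apply/seteqP; split => // t _; exists 0%N.
- move=> _ [K [C [iK FC ->]]] /=; rewrite /mrestr /mscale/=.
  rewrite fineK ?fin_num_measure// muleC.
  have := indepX (J := (i |` K)%fset) (A := fun j => if j == i then E else C j).
  rewrite (_ : \bigcap_(j in _) _ = \bigcap_(j in [set` K]) C j `&` E).
    rewrite big_fsetU1//= eqxx => ->.
      rewrite muleC; congr (_ * _)%E.
      have := indepX (J := K) (A := C) FC => ->.
      rewrite !big_seq; apply: eq_bigr => j jK.
      by case: eqP => // ji; move: iK; rewrite -ji jK.
    move=> j; rewrite in_fset1U; case: eqVneq => [-> _|_ /=].
      by exists B => //; rewrite setTI.
    exact: FC.
  apply/seteqP; split => t /=.
    move=> H; split=> [j /= jK|].
      have := H j; rewrite /= in_fset1U jK orbT => /(_ isT).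
      by case: eqP => // ji; move: iK; rewrite -ji jK.
    by have := H i; rewrite /= in_fset1U eqxx => /(_ isT).
  move=> [H1 H2] j /=; rewrite in_fset1U; case: eqVneq => [//|_ /= jK].
  exact: H1.
- by move=> k; rewrite /= /mrestr; rewrite ltey_eq fin_num_measure//; exact: measurableI.
Qed.

Lemma indep_fun_others i (Y : T -> R) (h : R -> R) :
  measurable_fun [set: g_sigma_algebraType (others i)] Y ->
  measurable_fun [set: R] h -> indep_fun P Y (fun t => h (X i t)).
Proof.
move=> mY mh A B mA mB.
apply: (@prob_others i (Y @^-1` A) (h @^-1` B)).
  by have := mY measurableT A mA; rewrite setTI.
by have := mh measurableT B mB; rewrite setTI.
Qed.

End independent_of_others.

(** * Walks frozen on leaving an interval *)

Section stopped_walk.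
Context (d : measure_display) (T : measurableType d) (R : realType).
Variables (a b : R) (z : nat -> T -> R).

Fixpoint stopped n (t : T) : R :=
  if n is m.+1 then
    if (- a < stopped m t) && (stopped m t < b) then stopped m t + z m t
    else stopped m t
  else 0.

Definition alive n t : R := ((- a < stopped n t) && (stopped n t < b))%:R.

Lemma measurable_stopped n : (forall i, (i < n)%N -> measurable_fun [set: T] (z i)) ->
  measurable_fun [set: T] (stopped n).
Proof.
elim: n => [|n IH] mz; first exact: measurable_cst.
have mn : measurable_fun [set: T] (stopped n) by apply: IH => i /ltnW; exact: mz.
apply: measurable_fun_ifT => //.
  by apply: measurable_and; apply: measurable_fun_ltr => //; exact: measurable_cst.
by apply: measurable_funD => //; exact: mz.
Qed.

Lemma measurable_alive n : (forall i, (i < n)%N -> measurable_fun [set: T] (z i)) ->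
  measurable_fun [set: T] (alive n).
Proof.
move=> /measurable_stopped mn.
rewrite (_ : alive n = fun t => if (- a < stopped n t) && (stopped n t < b) then 1 else 0).
  apply: measurable_fun_ifT => //; try exact: measurable_cst.
  by apply: measurable_and; apply: measurable_fun_ltr => //; exact: measurable_cst.
by apply/funext => t; rewrite /alive; case: ifP.
Qed.

Lemma stoppedS n t : stopped n.+1 t = stopped n t + alive n t * z n t.
Proof. by rewrite /alive/=; case: ifP => _; rewrite ?mul1r ?mul0r ?addr0. Qed.

Lemma alive_nonincreasing n t : alive n.+1 t <= alive n t.
Proof.
rewrite /alive /=; case: (boolP ((- a < stopped n t) && (stopped n t < b))) => // H.
  by rewrite lern1 leq_b1.
by rewrite (negbTE H).
Qed.

Lemma stopped_bound (C : R) n t : 0 < a -> 0 < b -> (forall i, `|z i t| <= C) ->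
  - a - C <= stopped n t <= b + C.
Proof.
move=> a0 b0 zC; have C0 : 0 <= C by apply: le_trans (zC 0%N).
elim: n => [|n IH] /=; first by apply/andP; split; lra.
case: ifP => // /andP[h1 h2]; have := zC n; rewrite ler_norml.
move=> /andP[h3 h4]; apply/andP; split; lra.
Qed.

Lemma stopped_success n t : 0 < a -> 0 < b -> b <= stopped n t ->
  exists2 m, (m <= n)%N & b <= \sum_(i < m) z i t /\
    forall j, (j <= m)%N -> - a <= \sum_(i < j) z i t.
Proof.
move=> a0 b0 bn.
have ex : exists m, b <= stopped m t by exists n.
case: (ex_minnP ex) => m bm mmin.
have lt_b k : (k < m)%N -> stopped k t < b.
  by move=> km; rewrite ltNge; apply/negP => /mmin; rewrite leqNgt km.
have gt_a k : (k < m)%N -> - a < stopped k t.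
  move=> km; rewrite ltNge; apply/negP => ka.
  (* A walk that has reached -a is frozen below b, so it could not be at b or above at time m. *)
  have stuck j : stopped (k + j) t = stopped k t.
    elim: j => [|j IH]; first by rewrite addn0.
    by rewrite addnS /= IH ltNge ka.
  by have := lt_b k km; rewrite -(stuck (m - k)%N) subnKC 1?ltnW// ltNge bm.
have SE j : (j <= m)%N -> stopped j t = \sum_(i < j) z i t.
  elim: j => [|j IH] jm; first by rewrite big_ord0.
  by rewrite big_ord_recr/= gt_a// lt_b//= IH// ltnW.
exists m; first exact: mmin.
split; first by rewrite -SE.
move=> j; rewrite leq_eqVlt => /predU1P[->|jm].
  by rewrite -SE//; lra.
by rewrite -SE 1?ltnW// ltW// gt_a.
Qed.

End stopped_walk.

(** * Exit of a centred walk from an interval *)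

Section exit_up.
Context (d : measure_display) (T : measurableType d) (R : realType)
  (P : probability T R) (I : choiceType) (X : I -> {RV P >-> R}).
Hypothesis indepX : independent_RVs X.
Variables (h : R -> R) (C s a b : R) (e : nat -> I) (n : nat) (A : set T).
Hypothesis mh : measurable_fun [set: R] h.
Hypothesis hC : forall u, `|h u| <= C.
Hypothesis e_inj : injective e.
Let z i t := h (X (e i) t).
Hypothesis mean_z : forall i, mean P (z i) = 0.
Hypothesis mean_z2 : forall i, mean P (fun t => z i t * z i t) = s.
Hypotheses (a0 : 0 < a) (b0 : 0 < b) (s0 : 0 < s).
Hypothesis A_others : forall i, (i < n)%N -> <<s others X (e i) >> A.
Hypothesis mA : measurable A.

Let M := stopped a b z.
Let L := alive a b z.
Let one := (\1_A : T -> R).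

Let mz i : measurable_fun [set: T] (z i).
Proof. by apply: measurableT_comp => //; exact: measurable_funPT. Qed.

Let bz i : bounded_mfun (z i).
Proof. by split=> //; exists C => t; exact: hC. Qed.

Let bM k : bounded_mfun (M k).
Proof.
split; first by apply: measurable_stopped.
exists (a + b + C) => t; have C0 : 0 <= C by apply: le_trans (hC 0).
have := stopped_bound (z := z) k a0 b0 (fun i => hC (X (e i) t)).
by rewrite ler_norml -/M => /andP[h1 h2]; have ha := a0; have hb := b0;
  apply/andP; split; lra.
Qed.

Let bL k : bounded_mfun (L k).
Proof.
split; first by apply: measurable_alive.
by exists 1 => t; rewrite /L /alive ger0_norm// lern1 leq_b1.
Qed.

Let b1 : bounded_mfun one. Proof. exact: bounded_mfun_indic. Qed.

Let bL1 k : bounded_mfun (fun t => L k t * one t).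
Proof. exact: bounded_mfunM. Qed.

Let mz_others k i : (i < k)%N ->
  measurable_fun [set: g_sigma_algebraType (others X (e k))] (z i).
Proof.
move=> ik; apply: measurableT_comp => //; apply: others_RV.
by apply/eqP => /e_inj ike; move: ik; rewrite ike ltnn.
Qed.

Let m1_others k : (k < n)%N ->
  measurable_fun [set: g_sigma_algebraType (others X (e k))] one.
Proof. by move=> kn; apply: measurable_indic; exact: A_others. Qed.

Let indep_z k (Y : T -> R) : bounded_mfun Y ->
  measurable_fun [set: g_sigma_algebraType (others X (e k))] Y ->
  mean P (fun t => Y t * z k t) = 0 /\
  mean P (fun t => Y t * (z k t * z k t)) = mean P Y * s.
Proof.
move=> bY mY; split.
  rewrite mean_indepM//; first by rewrite mean_z mulr0.
  exact: (indep_fun_others indepX mY mh).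
rewrite mean_indepM//; [by rewrite mean_z2|exact: bounded_mfunM|].
apply: (indep_fun_others indepX (h := fun u => h u * h u)) => //.
exact: measurable_funM.
Qed.

Let mean_stopped k : (k <= n)%N -> mean P (fun t => M k t * one t) = 0.
Proof.
elim: k => [|k IH] kn.
  rewrite (_ : (fun t => _) = cst 0) ?mean_cst//.
  by apply/funext => t; rewrite /M/= mul0r.
rewrite (_ : (fun t => _) = fun t => M k t * one t + (L k t * one t) * z k t).
  rewrite meanD ?IH 1?ltnW// ?add0r; [|exact: bounded_mfunM|exact: bounded_mfunM].
  apply: (indep_z (bL1 k) _).1; apply: measurable_funM; last exact: m1_others.
  by apply: measurable_alive => i; exact: mz_others.
by apply/funext => t; rewrite /M stoppedS -/M -/(L k t); ring.
Qed.

Let mean_stopped2 k : (k <= n)%N ->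
  s * k%:R * mean P (fun t => L k t * one t) <= mean P (fun t => M k t * M k t * one t).
Proof.
elim: k => [|k IH] kn.
  rewrite mulr0 mul0r (_ : (fun t => _) = cst 0) ?mean_cst//.
  by apply/funext => t; rewrite /M/= !mul0r.
have mL : measurable_fun [set: g_sigma_algebraType (others X (e k))] (fun t => L k t * one t).
  apply: measurable_funM; last exact: m1_others.
  by apply: measurable_alive => i; exact: mz_others.
have mML : measurable_fun [set: g_sigma_algebraType (others X (e k))]
    (fun t => M k t * (L k t * one t)).
  by apply: measurable_funM => //; apply: measurable_stopped => i; exact: mz_others.
have bML : bounded_mfun (fun t => M k t * (L k t * one t)) by exact: bounded_mfunM.
have [E1 _] := indep_z bML mML; have [_ E2] := indep_z (bL1 k) mL.
have bMM : bounded_mfun (fun t => M k t * M k t * one t).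
  by apply: bounded_mfunM => //; exact: bounded_mfunM.
have b2 : bounded_mfun (fun t => 2 * (M k t * (L k t * one t) * z k t)).
  by apply: bounded_mfunM; [exact: bounded_mfun_cst|exact: bounded_mfunM].
have b3 : bounded_mfun (fun t => L k t * one t * (z k t * z k t)).
  by apply: bounded_mfunM => //; exact: bounded_mfunM.
(* The second moment grows by exactly s times the mass still alive: the cross term has mean zero and
   [L k] is idempotent. As [L] is nonincreasing, the last alive mass bounds all earlier ones from
   below. *)
rewrite [leRHS](_ : _ = mean P (fun t => M k t * M k t * one t) +
    mean P (fun t => L k t * one t) * s); last first.
  rewrite -E2 -[X in X + _]addr0 -(mulr0 2) -E1 -meanZ; last exact: bounded_mfunM.
  rewrite -meanD// -meanD//; last exact: bounded_mfunD.
  congr mean; apply/funext => t; rewrite /M stoppedS -/M -/(L k t).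
  have LL : L k t * L k t = L k t.
    by rewrite /L /alive; case: (_ && _); rewrite ?mulr1 ?mulr0.
  move: (L k t) (M k t) (one t) (z k t) LL => l m o zz ll.
  rewrite (_ : (m + l * zz) * (m + l * zz) * o =
     m * m * o + 2 * (m * (l * o) * zz) + (l * l) * o * (zz * zz)); last by ring.
  by rewrite ll.
have le : mean P (fun t => L k.+1 t * one t) <= mean P (fun t => L k t * one t).
  apply: le_mean => // t; apply: ler_wpM2r; last exact: alive_nonincreasing.
  by rewrite /one indicE.
have hs := s0; have := IH (ltnW kn); rewrite -natr1.
have k0 : 0 <= k%:R :> R by [].
have : s * (k%:R + 1) * mean P (fun t => L k.+1 t * one t) <=
       s * (k%:R + 1) * mean P (fun t => L k t * one t).
  by apply: ler_wpM2l => //; rewrite mulr_ge0 ?addr_ge0// ltW.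
lra.
Qed.

(** Optional stopping restricted to A. On A, a + M n is at most a + b + C after an exit upwards, a +
    b if still inside, and 0 after an exit downwards. The stopped walk has mean zero on A, and the
    second moment makes the mass still inside so small that it absorbs at most half of a P(A). *)
Lemma exit_up : 2 * (a + b) * (a + b + C) ^+ 2 <= a * s * n%:R ->
  a * prob P A <= 2 * (a + b + C) * prob P (A `&` [set t | b <= M n t]).
Proof.
move=> big; have ha := a0; have hb := b0; have hs := s0.
have C0 : 0 <= C by apply: le_trans (hC 0).
set U := [set t | b <= M n t].
have mU : measurable U.
  rewrite /U -[X in measurable X]setTI; apply: measurable_fun_ler => //.
  by have [] := bM n.
have mAU : measurable (A `&` U) by exact: measurableI.
set tau := mean P (fun t => L n t * one t).
have tau0 : 0 <= tau.
  apply: Rintegral_ge0 => t _; apply: mulr_ge0; first by rewrite /L /alive.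
  by rewrite /one indicE.
have t2 : s * n%:R * tau <= (a + b + C) ^+ 2 * prob P A.
  apply: le_trans (mean_stopped2 (leqnn n)) _.
  rewrite -mean_indic// -meanZ//; apply: le_mean.
  - by apply: bounded_mfunM => //; exact: bounded_mfunM.
  - by apply: bounded_mfunM => //; exact: bounded_mfun_cst.
  move=> t; apply: ler_wpM2r; first by rewrite ?/one ?indicE.
  have := stopped_bound (z := z) n a0 b0 (fun i => hC (X (e i) t)).
  by rewrite -/M => /andP[h1 h2]; nra.
have t1 : a * prob P A <= (a + b + C) * prob P (A `&` U) + (a + b) * tau.
  rewrite -!mean_indic// -!meanZ//; [|exact: bounded_mfun_indic].
  rewrite -meanD; [|by apply: bounded_mfunM; [exact: bounded_mfun_cst|exact: bounded_mfun_indic]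
                   |by apply: bounded_mfunM; [exact: bounded_mfun_cst|]].
  (* The mean of M n on A is zero, so it may be added on the left; what remains is the pointwise
     comparison. *)
  rewrite -[leLHS]addr0 -(mean_stopped (leqnn n)) -meanD; last 2 first.
  - by apply: bounded_mfunM => //; exact: bounded_mfun_cst.
  - exact: bounded_mfunM.
  apply: le_mean.
  - by apply: bounded_mfunD; apply: bounded_mfunM => //; exact: bounded_mfun_cst.
  - apply: bounded_mfunD; apply: bounded_mfunM => //; try exact: bounded_mfun_cst.
    exact: bounded_mfun_indic.
  move=> t; rewrite /one !indicE in_setI.
  case: (t \in A); rewrite ?mulr0 ?addr0//= !mulr1.
  have := stopped_bound (z := z) n a0 b0 (fun i => hC (X (e i) t)); rewrite -/M => /andP[h1 h2].
  rewrite /L /alive -/M; have [tU|tU] := pselect (U t).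
    have tb : b <= M n t by [].
    by rewrite (mem_set tU) [M n t < b]ltNge tb andbF/= mulr0 addr0 mulr1; lra.
  have tb : M n t < b by rewrite ltNge; apply/negP.
  rewrite (memNset tU) tb andbT; case: ltP => h3 /=; lra.
have : a * (s * n%:R * tau) <= a * ((a + b + C) ^+ 2 * prob P A).
  by apply: ler_wpM2l => //; exact: ltW.
have abC : 0 < (a + b + C) ^+ 2 by rewrite exprn_gt0//; lra.
have p0 := prob_ge0 P A.
have : 2 * (a + b) * (a + b + C) ^+ 2 * tau <= a * s * n%:R * tau.
  exact: ler_wpM2r.
move=> h1 h2.
have : 2 * (a + b) * tau <= a * prob P A.
  rewrite -(ler_pM2l abC); lra.
lra.
Qed.

End exit_up.

(** * Valleys at infinitely many scales *)

Section scales.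
Context (d0 : measure_display) (T : measurableType d0) (R : realType)
  (P : probability T R) (X : int -> {RV P >-> R}).
Hypothesis indepX : independent_RVs X.
Variables (h : R -> R) (C s : R) (d : nat).
Hypothesis mh : measurable_fun [set: R] h.
Hypothesis hC : forall u, `|h u| <= C.
Hypothesis s0 : 0 < s.
Hypothesis mean_h : forall x, mean P (fun t => h (X x t)) = 0.
Hypothesis mean_h2 : forall x, mean P (fun t => h (X x t) * h (X x t)) = s.

(* [depth N] is the height of the walls divided by [4 * d]; it is large enough
   for [width N] steps of a centred walk to leave an interval of that order
   with high probability, while [width N] stays below [expR (depth N)]. *)
Definition scale_const : R := 4 * (4 * d%:R + 1) * (4 * d%:R + 2) ^+ 2 / s.
Definition depth (N : nat) : R :=
  27 * (8 * d%:R + 2 * scale_const + 4) + 2 * C * N%:R + N%:R + C + 1.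
Definition width (N : nat) : nat := (Num.truncn (scale_const * depth N ^+ 2)).+1.

(** The first N increments move the potential by at most C N <= depth / 2. Half of the depth is
    therefore reserved for them below, and the same amount is added to the target height 4 d depth
    above. *)
Definition floor_gap (N : nat) : R := depth N / 2.
Definition ceil_gap (N : nat) : R := 4 * d%:R * depth N + depth N / 2.

Definition right_site (N i : nat) : int := (N + i).+1%:Z.
Definition left_site (N i : nat) : int := - (N + i)%:Z.

Definition right_success N : set T :=
  [set t | ceil_gap N <= stopped (floor_gap N) (ceil_gap N)
             (fun i t => h (X (right_site N i) t)) (width N) t].
Definition left_success N : set T :=
  [set t | ceil_gap N <= stopped (floor_gap N) (ceil_gap N)
             (fun i t => - h (X (left_site N i) t)) (width N) t].

(** The sites -N < x <= N are those whose increments enter [potential_left N] and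
    [potential_right N]. Every other site is excluded separately, which is the form of independence
    used by [exit_up]. *)
Definition inner (N : nat) (A : set T) : Prop :=
  forall x : int, (x <= - N%:Z) || (N%:Z < x) -> <<s others X x >> A.

Lemma scale_const_ge0 : 0 <= scale_const.
Proof.
by rewrite /scale_const divr_ge0 ?(ltW s0)// mulr_ge0 ?sqr_ge0// mulr_ge0// addr_ge0.
Qed.

Let C0 : 0 <= C. Proof. exact: le_trans (hC 0). Qed.

Lemma depth_bounds N : [/\ 27 * (8 * d%:R + 2 * scale_const + 4) <= depth N,
  2 * C * N%:R <= depth N, N%:R <= depth N, C <= depth N & 1 <= depth N].
Proof.
have g0 := scale_const_ge0; have c0 := C0.
have dd : 0 <= d%:R :> R by []. have NN : 0 <= N%:R :> R by [].
have cn : 0 <= 2 * C * N%:R by rewrite !mulr_ge0.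
by rewrite /depth; split; lra.
Qed.

Lemma width_ge N : scale_const * depth N ^+ 2 <= (width N)%:R.
Proof. by rewrite ltW// /width truncnS_gt. Qed.

Lemma width_le N : (width N)%:R <= scale_const * depth N ^+ 2 + 1.
Proof.
rewrite /width -natr1 lerD2r truncn_le.
by rewrite mulr_ge0 ?scale_const_ge0 ?sqr_ge0.
Qed.

(** The exponential dominates the cube of depth / 3, while the width is quadratic in the depth; the
    27 in [depth] is the cube of this 3. *)
Lemma width_exp N : 2 * (N + width N)%:R + 2 <= expR (depth N).
Proof.
have [h1 h2 h3 h4 h5] := depth_bounds N; have wl := width_le N.
have g0 := scale_const_ge0; have dd : 0 <= d%:R :> R by [].
have e3 : (depth N / 3) ^+ 3 <= expR (depth N).
  have -> : expR (depth N) = expR (depth N / 3) ^+ 3.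
    by rewrite -expRM_natr; congr expR; field.
  rewrite lerXn2r ?nnegrE ?expR_ge0//; first by lra.
  by have := expR_ge1Dx (depth N / 3); lra.
apply: le_trans e3; rewrite natrD.
move: (depth N) (scale_const) (d%:R : R) (N%:R : R) ((width N)%:R : R) h1 h2 h3 h4 h5 wl g0 dd.
move=> y g e n w h1 h2 h3 h4 h5 wl g0 e0.
have y2 : y <= y ^+ 2 by rewrite expr2; nra.
have : 27 * (8 * e + 2 * g + 4) * y ^+ 2 <= y * y ^+ 2 by rewrite ler_wpM2r// sqr_ge0.
have : 0 <= e * y ^+ 2 by rewrite mulr_ge0 ?sqr_ge0.
have -> : (y / 3) ^+ 3 = y * y ^+ 2 / 27 by field.
lra.
Qed.

(** With y the depth, a = y/2, a + b = (4d + 1) y and a + b + C <= (4d + 2) y. The hypothesis of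
    [exit_up] then asks for at least [scale_const] times y^2 steps, and the ratio 2 (a + b + C) / a
    is at most 8 (2d + 1). *)
Lemma exit_up_scale N (k : R -> R) (e : nat -> int) (A : set T) :
  measurable_fun [set: R] k -> (forall u, `|k u| <= C) -> injective e ->
  (forall i, mean P (fun t => k (X (e i) t)) = 0) ->
  (forall i, mean P (fun t => k (X (e i) t) * k (X (e i) t)) = s) ->
  (forall i, <<s others X (e i) >> A) ->
  prob P A <= 8 * (2 * d%:R + 1) * prob P (A `&`
    [set t | ceil_gap N <= stopped (floor_gap N) (ceil_gap N)
             (fun i t => k (X (e i) t)) (width N) t]).
Proof.
move=> mk kC e_inj k1 k2 Ae.
have [h1 h2 h3 h4 h5] := depth_bounds N; have wg := width_ge N.
have s1 := s0; have c0 := C0; have dd : 0 <= d%:R :> R by [].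
have mA := others_measurable (Ae 0%N).
have a0 : 0 < floor_gap N by rewrite /floor_gap; lra.
have dy : 0 <= d%:R * depth N by rewrite mulr_ge0//; lra.
have b0 : 0 < ceil_gap N by rewrite /ceil_gap -mulrA; lra.
have := exit_up (n := width N) indepX mk kC e_inj k1 k2 a0 b0 s0 (fun i _ => Ae i) mA.
set U := prob P (_ `&` _); have U0 : 0 <= U by exact: prob_ge0.
have ab : floor_gap N + ceil_gap N = (4 * d%:R + 1) * depth N.
  by rewrite /floor_gap /ceil_gap; lra.
rewrite ab /floor_gap.
move: (prob P A) (depth N) h1 h2 h3 h4 h5 wg dy => p y h1 h2 h3 h4 h5 wg dy H.
have abC : (4 * d%:R + 1) * y + C <= (4 * d%:R + 2) * y by lra.
have abC0 : 0 <= (4 * d%:R + 1) * y + C.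
  by rewrite addr_ge0// mulr_ge0//; lra.
have {}H : y / 2 * p <= 2 * ((4 * d%:R + 1) * y + C) * U.
  apply: H; apply: (@le_trans _ _ (2 * ((4 * d%:R + 1) * y) * ((4 * d%:R + 2) * y) ^+ 2)).
    rewrite ler_wpM2l//; first by rewrite mulr_ge0// mulr_ge0//; lra.
    by rewrite lerXn2r ?nnegrE//; apply: le_trans abC0 abC.
  have -> : 2 * ((4 * d%:R + 1) * y) * ((4 * d%:R + 2) * y) ^+ 2 =
      y / 2 * s * (scale_const * y ^+ 2).
    by rewrite /scale_const; field; lra.
  by rewrite ler_wpM2l// mulr_ge0//; lra.
have : 2 * ((4 * d%:R + 1) * y + C) * U <= 2 * ((4 * d%:R + 2) * y) * U.
  by rewrite ler_wpM2r// ler_wpM2l.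
move=> H2; have y0 : 0 < y / 2 by lra.
rewrite -(ler_pM2l y0); apply: le_trans H _; apply: le_trans H2 _.
lra.
Qed.

Lemma right_success_gt N A : inner N A ->
  prob P A <= 8 * (2 * d%:R + 1) * prob P (A `&` right_success N).
Proof.
move=> iA; apply: (exit_up_scale N (k := h) (e := right_site N)) => //.
- by move=> i j; rewrite /right_site; lia.
- by move=> i; apply: iA; rewrite /right_site; apply/orP; right; lia.
Qed.

Lemma others_success N x (z : nat -> T -> R) :
  (forall i, (i < width N)%N ->
    measurable_fun [set: g_sigma_algebraType (others X x)] (z i)) ->
  <<s others X x >> [set t | ceil_gap N <=
    stopped (floor_gap N) (ceil_gap N) z (width N) t].
Proof.
move=> mz.
have mM : measurable_fun [set: g_sigma_algebraType (others X x)]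
    (stopped (floor_gap N) (ceil_gap N) z (width N)).
  exact: (@measurable_stopped _ (g_sigma_algebraType (others X x)) R _ _ z _ mz).
have := measurable_fun_ler
  (measurable_cst (ceil_gap N) : measurable_fun [set: g_sigma_algebraType (others X x)] _) mM.
move=> /(_ measurableT [set true] I); rewrite setTI.
exact.
Qed.

Lemma others_right_success N x :
  (forall i, (i < width N)%N -> right_site N i != x) ->
  <<s others X x >> (right_success N).
Proof.
move=> ne; apply: others_success => i iw; apply: measurableT_comp => //.
exact: others_RV (ne i iw).
Qed.

Lemma others_left_success N x :
  (forall i, (i < width N)%N -> left_site N i != x) ->
  <<s others X x >> (left_success N).
Proof.
move=> ne; apply: others_success => i iw; apply: measurable_funN.
by apply: measurableT_comp => //; exact: others_RV (ne i iw).
Qed.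

Lemma othersI x A B : <<s others X x >> A -> <<s others X x >> B ->
  <<s others X x >> (A `&` B).
Proof. exact: (@measurableI _ (g_sigma_algebraType (others X x))). Qed.

Lemma othersC x A : <<s others X x >> A -> <<s others X x >> (~` A).
Proof. exact: (@measurableC _ (g_sigma_algebraType (others X x))). Qed.

(** The right success does not involve the left sites, so the exit estimate applies again on the
    smaller event, with the sign of the increments reversed. *)
Lemma left_success_gt N A : inner N A ->
  prob P (A `&` right_success N) <= 8 * (2 * d%:R + 1) *
    prob P (A `&` right_success N `&` left_success N).
Proof.
move=> iA.
apply: (exit_up_scale N (k := fun u => - h u) (e := left_site N)) => //.
- exact: measurable_funN.
- by move=> u; rewrite normrN.
- by move=> i j; rewrite /left_site; lia.
- move=> i; have := mean_h (left_site N i).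
  have b : bounded_mfun (fun t => h (X (left_site N i) t)).
    split; last by exists C => t; exact: hC.
    by apply: measurableT_comp => //; exact: measurable_funPT.
  have := meanZ P (-1) b; rewrite mean_h mulr0 => <- _.
  by congr mean; apply/funext => t; rewrite mulN1r.
- move=> i; rewrite -(mean_h2 (left_site N i)).
  by congr mean; apply/funext => t; rewrite mulrNN.
- move=> i; apply: othersI; first by apply: iA; rewrite /left_site; apply/orP; left; lia.
  by apply: others_right_success => j _; rewrite /left_site /right_site; lia.
Qed.

(** Each scale begins where the preceding one stopped looking, so the successes depend on disjoint
    blocks of sites. *)
Fixpoint scale (k : nat) : nat :=
  if k is k'.+1 then (scale k' + width (scale k'))%N else 0%N.

Definition success k : set T := right_success (scale k) `&` left_success (scale k).

Lemma scale_ge k : (k <= scale k)%N.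
Proof. by elim: k => //= k IH; rewrite /width addnS ltnS (leq_trans IH) ?leq_addr. Qed.

Lemma inner_success k A : inner (scale k) A -> inner (scale k.+1) (A `&` ~` success k).
Proof.
move=> iA x; rewrite [scale k.+1]/= => hx; apply: othersI.
  by apply: iA; move: hx; move: (width _) => W; lia.
apply: othersC; apply: othersI.
  apply: others_right_success => i iw; move: hx iw; rewrite /right_site.
  by move: (width _) => W; lia.
apply: others_left_success => i iw; move: hx iw; rewrite /left_site.
by move: (width _) => W; lia.
Qed.

Definition fail_prob : R := 1 - (8 * (2 * d%:R + 1)) ^- 2.

Lemma inner_measurable N A : inner N A -> measurable A.
Proof.
move=> /(_ (N.+1)%:Z) iA; apply: (@others_measurable _ _ _ _ _ X (N.+1)%:Z); apply: iA.
by apply/orP; right; lia.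
Qed.

Lemma inner_success_prob k A : inner (scale k) A ->
  prob P (A `&` ~` success k) <= fail_prob * prob P A.
Proof.
move=> iA; have mA := inner_measurable iA.
have mS : measurable (success k).
  apply: (@others_measurable _ _ _ _ _ X (scale k.+1).+1%:Z); apply: othersI.
    apply: others_right_success => i; rewrite /right_site/=.
    by move: (width _) => W; lia.
  apply: others_left_success => i; rewrite /left_site/=.
  by move: (width _) => W; lia.
have := probD P mA mS; have := right_success_gt iA; have := left_success_gt iA.
rewrite -setIA -/(success k) /fail_prob.
set c := 8 * _; have c0 : 0 < c.
  by rewrite /c mulr_gt0// ltr_pwDr// mulr_ge0.
move=> h1 h2 h3.
have h4 : prob P A <= c ^+ 2 * prob P (A `&` success k).
  by rewrite expr2 -mulrA (le_trans h2)// ler_wpM2l// ltW.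
have h5 : c ^- 2 * prob P A <= prob P (A `&` success k).
  by rewrite ler_pdivrMl// exprn_gt0.
rewrite mulrBl mul1r; lra.
Qed.

Lemma fail_prob_bounds : 0 <= fail_prob < 1.
Proof.
have c1 : 1 <= 8 * (2 * d%:R + 1) :> R.
  by have : 0 <= d%:R :> R by []; lra.
have c0 : 0 < 8 * (2 * d%:R + 1) :> R by lra.
rewrite /fail_prob subr_ge0 invf_le1 ?exprn_gt0// exprn_ege1//=.
Qed.

(** Each further scale multiplies the probability of uninterrupted failure by at most [fail_prob] <
    1, so failing from scale m on forever has probability zero; a countable union over m remains. *)
Lemma infinitely_many_successes :
  {ae P, forall t, forall m, exists2 k, (m <= k)%N & success k t}.
Proof.
pose A m j := \bigcap_(k in `I_j) ~` success (m + k).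
have AS m j : A m j.+1 = A m j `&` ~` success (m + j).
  apply/seteqP; split => t.
    move=> H; split; last by apply: H => /=.
    by move=> k /= kj; apply: H => /=; exact: leqW.
  move=> [H1 H2] k /=; rewrite ltnS leq_eqVlt => /predU1P[->//|kj].
  exact: H1.
have iA m j : inner (scale (m + j)) (A m j).
  elim: j => [|j IH]; last by rewrite AS addnS; exact: inner_success.
  move=> x _; rewrite (_ : A m 0%N = setT).
    exact: (@measurableT _ (g_sigma_algebraType (others X x))).
  by apply/seteqP; split => t // _ k.
have mA m j : measurable (A m j) := inner_measurable (iA m j).
have [f0 f1] := andP fail_prob_bounds.
have PA m j : prob P (A m j) <= fail_prob ^+ j.
  elim: j => [|j IH]; first by rewrite expr0 prob_le1.
  rewrite AS exprS (le_trans (inner_success_prob (iA m j)))//.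
  exact: ler_wpM2l.
pose B m := \bigcap_(k in [set k | (m <= k)%N]) ~` success k.
suff B0 m : P.-negligible (B m).
  apply: negligibleS (negligible_bigcup B0) => t /= /existsNP[m Hm].
  by exists m => // k /= mk sk; apply: Hm; exists k.
have BA j : B m `<=` A m j by move=> t Bt k _; apply: Bt => /=; exact: leq_addr.
have mB : measurable (\bigcap_j A m j) by exact: bigcapT_measurable.
apply: (@negligibleS _ _ _ _ (\bigcap_j A m j)); first by move=> t Bt j _; exact: BA.
apply/(negligibleP _ mB); apply: etrans (probE P mB) _; congr EFin.
apply/eqP; rewrite eq_le prob_ge0 andbT.
have cv : fail_prob ^+ j @[j --> \oo] --> (0 : R) by apply: cvg_expr; rewrite ger0_norm.
apply/ler_addgt0Pr => e e0; rewrite add0r.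
move/cvgrPdist_lt: cv => /(_ e e0)[j _ /(_ j (leqnn j))].
rewrite sub0r normrN ger0_norm ?exprn_ge0// => /ltW; apply: le_trans.
apply: le_trans (PA m j); apply: le_prob => //.
by move=> t; apply.
Qed.

End scales.

(** The first N terms contribute at least -C N >= -y/2, which the spare y/2 in both assumptions on
    the shifted sums compensates. *)
Lemma sum_shift_valley (R : realType) (f : nat -> R) (C y H : R) (N m : nat) :
  (forall i, `|f i| <= C) -> 2 * C * N%:R <= y ->
  H + y / 2 <= \sum_(i < m) f (N + i)%N ->
  (forall j, (j <= m)%N -> - (y / 2) <= \sum_(i < j) f (N + i)%N) ->
  H <= \sum_(i < N + m) f i /\
  forall j, (j <= N + m)%N -> - y <= \sum_(i < j) f i.
Proof.
move=> fC CN top bottom.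
have low j : (j <= N)%N -> - (y / 2) <= \sum_(i < j) f i.
  move=> jN; have C0 : 0 <= C by exact: le_trans (fC 0%N).
  apply: (@le_trans _ _ (- (C * N%:R))); first by lra.
  apply: (@le_trans _ _ (- (C * j%:R))).
    by rewrite lerN2 ler_wpM2l// ler_nat.
  have -> : - (C * j%:R) = \sum_(i < j) - C.
    by rewrite sumr_const card_ord mulNrn mulr_natr.
  apply: ler_sum => i _.
  by have := fC i; rewrite ler_norml => /andP[].
have split j : \sum_(i < N + j) f i = \sum_(i < N) f i + \sum_(i < j) f (N + i)%N.
  by rewrite big_split_ord.
split; first by rewrite split; have := low N (leqnn N); lra.
move=> j jNm; have [jN|Nj] := leqP j N.
  have := low j jN; have := low 0%N isT; rewrite big_ord0; lra.
rewrite -(subnKC (ltnW Nj)) split; have := low N (leqnn N).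
have : (j - N <= m)%N by rewrite leq_subLR.
by move=> /bottom; lra.
Qed.

(** The exit estimate needs increments bounded at every point, but ellipticity holds only almost
    surely; the value 0 elsewhere changes the increments on a null set only. *)
Definition clipped_log_rho (R : realType) (eps u : R) : R :=
  if (eps <= u) && (u <= 1 - eps) then ln (1 - u) - ln u else 0.

Lemma log_rhoE (R : realType) (u : R) : 0 < u < 1 -> log_rho u = ln (1 - u) - ln u.
Proof. by move=> u01; rewrite /log_rho ln_div// posrE; lra. Qed.

Lemma clipped_log_rhoE (R : realType) (eps u : R) : 0 < eps ->
  eps <= u <= 1 - eps -> clipped_log_rho eps u = log_rho u.
Proof. by move=> e0 ue; rewrite /clipped_log_rho ue log_rhoE//; lra. Qed.

Lemma measurable_log_diff (R : realType) :
  measurable_fun [set: R] (fun u : R => ln (1 - u) - ln u).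
Proof.
apply: measurable_funB => //; apply: measurableT_comp => //.
by apply: measurable_funB => //; exact: measurable_cst.
Qed.

Lemma measurable_clipped_log_rho (R : realType) (eps : R) :
  measurable_fun [set: R] (clipped_log_rho eps).
Proof.
apply: measurable_fun_ifT; [|exact: measurable_log_diff|exact: measurable_cst].
by apply: measurable_and; apply: measurable_fun_ler => //; exact: measurable_cst.
Qed.

Lemma clipped_log_rho_le (R : realType) (eps u : R) : 0 < eps < 2^-1 ->
  `|clipped_log_rho eps u| <= - ln eps.
Proof.
move=> e01; have ln0 : ln eps <= 0 by apply: ln_le0; lra.
rewrite /clipped_log_rho; case: ifP => [/andP[h1 h2]|_]; last by rewrite normr0; lra.
have l1 : ln (1 - u) <= 0 by apply: ln_le0; lra.
have l2 : ln u <= 0 by apply: ln_le0; lra.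
have l3 : ln eps <= ln u by rewrite ler_ln ?posrE; lra.
have l4 : ln eps <= ln (1 - u) by rewrite ler_ln ?posrE; lra.
by rewrite ler_norml; apply/andP; split; lra.
Qed.

Lemma mean_identically_distributed (d : measure_display) (T : measurableType d)
    (R : realType) (P : probability T R) (I : Type) (X : I -> {RV P >-> R})
    (h : R -> R) (i j : I) :
  identically_distributed X -> bounded_mfun h ->
  mean P (fun t => h (X i t)) = mean P (fun t => h (X j t)).
Proof.
move=> idX bh; rewrite /mean /Rintegral; congr fine.
have E k : (\int[P]_t (h (X k t))%:E = \int[distribution P (X k)]_u (h u)%:E)%E.
  have [mh _] := bh.
  apply/esym; apply: (@integral_distribution _ _ _ _ _ P (X k) (EFin \o h)).
    exact/measurable_EFinP.
  have [_ [M hM]] := bh.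
  apply: (@bounded_mfun_integrable _ _ _ P (fun t => h (X k t))); split.
    by apply: measurableT_comp => //; exact: measurable_funPT.
  by exists M => t; exact: hM.
rewrite !E; apply: eq_measure_integral => A mA _; exact: idX.
Qed.


(** * Almost sure ellipticity and the moments of the increments *)

Section random_environment.
Context (R : realType) (d0 : measure_display) (Omega : measurableType d0)
  (P : probability Omega R) (omega : int -> {RV P >-> R}) (eps : R).
Hypothesis omega01 : forall (x : int) (w : Omega), 0 < omega x w < 1.
Hypothesis omega_id : identically_distributed omega.
Hypothesis eps01 : 0 < eps < 2^-1.
Hypothesis elliptic : P [set w | eps <= omega 0 w <= 1 - eps] = 1%E.

Let mclip x : measurable_fun [set: Omega] (fun w => clipped_log_rho eps (omega x w)).
Proof.
apply: measurableT_comp; first exact: measurable_clipped_log_rho.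
exact: measurable_funPT.
Qed.

Let mlog : measurable_fun [set: Omega] (fun w => log_rho (omega 0 w)).
Proof.
rewrite (_ : (fun w => _) = (fun u => ln (1 - u) - ln u) \o omega 0).
  by apply: measurableT_comp; [exact: measurable_log_diff|exact: measurable_funPT].
by apply/funext => w; rewrite log_rhoE.
Qed.

Lemma elliptic_everywhere :
  {ae P, forall w, forall x, eps <= omega x w <= 1 - eps}.
Proof.
have mI : measurable [set u : R | eps <= u <= 1 - eps].
  have -> : [set u : R | eps <= u <= 1 - eps] = `[eps, 1 - eps]%classic.
    by apply/seteqP; split => u /=; rewrite in_itv.
  exact: measurable_itv.
have N x : P.-negligible [set w | ~ (eps <= omega x w <= 1 - eps)].
  have mx : measurable [set w | eps <= omega x w <= 1 - eps].
    exact: (measurable_funPTI (omega x) mI).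
  apply/(negligibleP P (measurableC mx)); apply: etrans (probability_setC P mx) _.
  have -> : P [set w | eps <= omega x w <= 1 - eps] = 1%E.
    by rewrite -elliptic; exact: (omega_id x 0 mI).
  by rewrite subee.
have NN := negligibleU (negligible_bigcup (fun k => N (Posz k)))
  (negligible_bigcup (fun k => N (Negz k))).
apply: negligibleS NN => w /= /existsNP[[k|k] Hk]; [left|right]; by exists k.
Qed.

Let ae_log : {ae P, forall w, clipped_log_rho eps (omega 0 w) = log_rho (omega 0 w)}.
Proof.
apply: filterS elliptic_everywhere => w H; apply: clipped_log_rhoE (H 0).
by case/andP: eps01.
Qed.

Lemma mean_clipped_log_rho : ('E_P[fun w => log_rho (omega 0 w)] = 0)%E ->
  mean P (fun w => clipped_log_rho eps (omega 0 w)) = 0.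
Proof.
move=> E0; rewrite /mean /Rintegral.
rewrite -[RHS](congr1 fine (erefl 0%E)) -E0 unlock; congr fine.
apply: ae_eq_integral => //; [exact/measurable_EFinP|exact/measurable_EFinP|].
by apply: filterS ae_log => w /= -> _.
Qed.

Lemma mean_sqr_clipped_log_rho : ('E_P[fun w => log_rho (omega 0 w)] = 0)%E ->
  (0 < 'V_P[fun w => log_rho (omega 0 w)])%E ->
  0 < mean P (fun w => clipped_log_rho eps (omega 0 w) * clipped_log_rho eps (omega 0 w)).
Proof.
move=> E0; rewrite /variance unlock E0 /= unlock.
set f := (X in (\int[P]_w (X w)%:E)%E).
(* The mean being zero, the variance is the second moment. *)
have fE : f = fun w => log_rho (omega 0 w) * log_rho (omega 0 w).
  by apply/funext => w; rewrite /f fctE /= !subr0.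
rewrite fE.
have bc : bounded_mfun (fun w => clipped_log_rho eps (omega 0 w)).
  by split; [exact: mclip|exists (- ln eps) => w; exact: clipped_log_rho_le].
rewrite (_ : (\int[P]_w _)%E = (mean P (fun w =>
  clipped_log_rho eps (omega 0 w) * clipped_log_rho eps (omega 0 w)))%:E) ?lte_fin//.
rewrite -meanE; last exact: bounded_mfunM.
apply: ae_eq_integral => //.
- by apply/measurable_EFinP; exact: measurable_funM.
- by apply/measurable_EFinP; exact: measurable_funM.
by apply: filterS ae_log => w /= -> _.
Qed.

End random_environment.

(** * From successful scales to recurrence *)

Theorem corollary6p2 (R : realType) (d0 : measure_display)
    (Omega : measurableType d0) (P : probability Omega R)
    (omega : int -> {RV P >-> R})
    (omega01 : forall (x : int) (w : Omega), 0 < omega x w < 1)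
    (omega_indep : independent_RVs omega)
    (omega_id : identically_distributed omega)
    (E_log_rho0 : ('E_P[fun w => log_rho (omega 0%R w)] = 0)%E)
    (elliptic : exists eps : R, 0 < eps < 2^-1 /\
       P [set w | eps <= omega 0 w <= 1 - eps] = 1%E)
    (V_log_rho0 : (0 < 'V_P[fun w => log_rho (omega 0%R w)])%E)
    (d : nat) (d_gt0 : (0 < d)%N) :
  {ae P, forall w : Omega,
    forall (d1 : measure_display) (T : measurableType d1)
      (P_omega : probability T R) (X : 'I_d -> nat -> {RV P_omega >-> int}),
    (forall i : 'I_d, walk_in_environment (fun x => omega x w) (X i)) ->
    independent_processes X ->
    recurrent P_omega (fun (n : nat) (t : T) => \row_(i < d) X i n t)}.
Proof.
have [eps [eps01 ell]] := elliptic; have /andP[eps0 _] := eps01.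
pose h := clipped_log_rho eps; pose C := - ln eps.
have mh : measurable_fun [set: R] h by exact: measurable_clipped_log_rho.
have hC u : `|h u| <= C by exact: clipped_log_rho_le.
have bh : bounded_mfun h by split => //; exists C.
have bhh : bounded_mfun (fun u => h u * h u) by exact: bounded_mfunM.
have m1 x : mean P (fun w => h (omega x w)) = 0.
  rewrite (mean_identically_distributed x 0 omega_id bh).
  exact: (mean_clipped_log_rho omega01 omega_id eps01 ell E_log_rho0).
pose s := mean P (fun w => h (omega 0 w) * h (omega 0 w)).
have s0 : 0 < s.
  exact: (mean_sqr_clipped_log_rho omega01 omega_id eps01 ell E_log_rho0 V_log_rho0).
have m2 x : mean P (fun w => h (omega x w) * h (omega x w)) = s.
  exact: (mean_identically_distributed x 0 omega_id bhh).
have := infinitely_many_successes omega_indep d mh hC s0 m1 m2.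
apply: filterS2 (elliptic_everywhere omega_id ell).
(* From here the environment is fixed; both properties retained of it are independent of the space
   carrying the walks. *)
move=> w env_eps succ d1 T P_omega X walkX indepX.
apply: (valley_recurrent d_gt0 eps0 env_eps walkX indepX) => K.
have hE x : h (omega x w) = log_rho (omega x w) by exact: clipped_log_rhoE.
(* Then K < k <= N <= y <= 4 d y, the height of the valley. *)
have [k kK [sR sL]] := succ (Num.truncn K).+1.
set N := scale C s d k in sR sL.
have [_ y2 y3 _ y5] := depth_bounds d hC s0 N.
set y := depth C s d N in y2 y3 y5.
have a0 : 0 < floor_gap C s d N by rewrite /floor_gap -/y; lra.
have dR : 1 <= d%:R :> R by rewrite ler1n.
have dy : y <= d%:R * y by rewrite ler_peMl//; lra.
have b0 : 0 < ceil_gap C s d N by rewrite /ceil_gap -/y; lra.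
have [mR mRW [topR botR]] := stopped_success a0 b0 sR.
have [mL mLW [topL botL]] := stopped_success a0 b0 sL.
have [VR VR'] := @sum_shift_valley R (fun i => h (omega i.+1%:Z w)) C y
  (4 * d%:R * y) N mR (fun i => hC _) y2 topR botR.
have [VL VL'] := @sum_shift_valley R (fun i => - h (omega (- i%:Z) w)) C y
  (4 * d%:R * y) N mL (fun i => etrans (congr1 (fun u => u <= C) (normrN _)) (hC _))
  y2 topL botL.
have potR j : \sum_(i < j) h (omega i.+1%:Z w) =
    potential_right (fun x => omega x w) j.
  by apply: eq_bigr => i _; rewrite hE.
have potL j : \sum_(i < j) - h (omega (- i%:Z) w) =
    potential_left (fun x => omega x w) j.
  by apply: eq_bigr => i _; rewrite hE.
exists (4 * d%:R * y), (N + mL)%N, (N + mR)%N.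
have yE : 4 * d%:R * y / (4 * d%:R) = y by field; rewrite gt_eqF//; lra.
rewrite yE; split.
- have : K < N%:R.
    apply: lt_le_trans (truncnS_gt K) _; rewrite ler_nat.
    exact: leq_trans kK (scale_ge C s d k).
  lra.
- split; rewrite -?potR -?potL// => j jN; rewrite -?potR -?potL.
  + exact: VL'.
  + exact: VR'.
(* Both walls lie within distance N + width of 0, so the valley is no wider than the quantity
   bounded by [width_exp]. *)
- apply: le_trans (width_exp d hC s0 N).
  have : (N + mL + (N + mR) + 2)%:R <= (2 * (N + width C s d N) + 2)%:R :> R.
    by rewrite ler_nat leq_add2r mul2n -addnn leq_add// leq_add2l.
  by rewrite [leRHS]natrD natrM.
Qed.
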